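(* There exist absolute constants $c_0\in(0,\tfrac14)$ and $c, C, C', C''>0$ such that the following holds for all integers $d\ge 3$, $n,k\ge 1$, all $\alpha\in(0,1)$ and all $\epsilon\in(0,c_0)$ such that $n(1-\epsilon)$ is an integer. With $\delta = C'e^{-d}$, the minimax rate $\psi^*_\delta(n,k,\alpha,d,\epsilon)$ satisfies $$\psi^*_\delta(n,k,\alpha,d,\epsilon)\;\ge\; c\left\{\left(\frac{d}{\alpha\sqrt{kn}}+\frac{\epsilon}{\alpha}\sqrt{\frac dk}\right)\wedge 1\right\},$$ and, if moreover $n\ge C''d$, then $$\psi^*_\delta(n,k,\alpha,d,\epsilon)\;\le\; C\left\{\left(\frac{d}{\alpha\sqrt{kn}}+\frac{\epsilon\sqrt{\log(1/\epsilon)}}{\alpha}\sqrt{\frac dk}\right)\wedge 1\right\}.$$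
   Context: Notation: $a\wedge b=\min(a,b)$, $[m]=\{1,\dots,m\}$, $\|x\|_1=\sum_j|x_j|$, and $\mathcal P_d=\{p\in\mathbb R^d: p_j\ge 0\ \forall j,\ \sum_{j=1}^d p_j=1\}$. Local differential privacy: a Markov transition kernel $Q$ from $[d]$ to a measurable space $(\mathcal Z,\mathcal B)$ is an $\alpha$-locally differentially private ($\alpha$-LDP) mechanism if $\sup_{B\in\mathcal B}\sup_{x,x'\in[d]}\frac{Q(B|x)}{Q(B|x')}\le e^{\alpha}$. For $p\in\mathcal P_d$, $Qp$ denotes the distribution $\sum_{j\in[d]}p_jQ(\cdot|j)$ on $\mathcal Z$, i.e. the law of $Z$ when $X\sim p$ and $Z|X\sim Q(\cdot|X)$. Clean data: put $n'=n(1-\epsilon)$. The clean privatized batches are $Y=(Y^1,\dots,Y^{n'})$ with $Y^b=(Y^b_1,\dots,Y^b_k)$, where all $Y^b_l$ are i.i.d. with law $Qp$; $\mathbb P_p$ denotes the corresponding probability. Contamination: $\mathcal C(Y)=\mathcal C(Y^1,\dots,Y^{n'})$ is the set of all families $(Z^b)_{b=1}^n$ of $n$ batches in $\mathcal Z^k$ for which there is $J\subset[n]$ with $|J|=n\epsilon$ and $\{Z^b\}_{b\notin J}=\{Y^1,\dots,Y^{n'}\}$ (equality as collections, i.e. with multiplicities). An estimator is a measurable map $\widehat p:\mathcal Z^{nk}\to\mathcal P_d$. The minimax rate is $$\psi^*_\delta(n,k,\alpha,d,\epsilon)=\inf\Big\{\psi>0:\ \inf_{\widehat p,\,Q}\ \sup_{p\in\mathcal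 P_d}\ \mathbb P_p\Big(\sup_{z\in\mathcal C(Y)}\|\widehat p(z)-p\|_1>\psi\Big)\le\delta\Big\},$$ where the inner infimum is over all $\alpha$-LDP mechanisms $Q$ (with arbitrary image space $\mathcal Z$) and all estimators $\widehat p$. ''Absolute constant'' means independent of $d,n,k,\alpha,\epsilon,p,Q$. *)

(* Defs.v *)
From HB Require Import structures.
From mathcomp Require Export all_boot all_order all_algebra.
From mathcomp Require Export all_classical all_reals all_analysis.

Set Implicit Arguments.
Unset Strict Implicit.
Unset Printing Implicit Defensive.

Import Order.TTheory GRing.Theory Num.Theory.

Local Open Scope classical_set_scope.
Local Open Scope ring_scope.

Definition in_simplex (R : realType) (d : nat) (p : d.-tuple R) : bool :=
  [forall j, 0 <= tnth p j] && (\sum_(j < d) tnth p j == 1).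

Definition simplex (R : realType) (d : nat) : Type :=
  {p : d.-tuple R | in_simplex p}.

Definition l1_dist (R : realType) (d : nat) (p q : d.-tuple R) : R :=
  \sum_(j < d) `|tnth p j - tnth q j|.

(* As [d] carries the discrete sigma-algebra, a Markov kernel from [d] to Z is
   nothing but a family of probability measures on Z indexed by 'I_d.
   In \bar R, x / 0 = +oo for x > 0 and 0 / 0 = 0, so that the sets B which
   are null for both Q x and Q x' impose no constraint. *)
Definition LDP (R : realType) (disp : measure_display)
    (Z : measurableType disp) (d : nat) (alpha : R)
    (Q : 'I_d -> probability Z R) : Prop :=
  (ereal_sup [set ereal_sup [set Q x B / Q x' B | x in setT & x' in setT]
             | B in measurable] <= (expR alpha)%:E)%E.

Section mixture.
Local Open Scope ereal_scope.
Context (R : realType) (disp : measure_display) (Z : measurableType disp).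
Context (d : nat) (Q : 'I_d -> probability Z R) (p : simplex R d).

Definition mixture (B : set Z) : \bar R :=
  \sum_(j < d) (tnth (val p) j)%:E * Q j B.

Let p_ge0 j : (0 <= tnth (val p) j)%R.
Proof. by have /andP[/forallP] := valP p. Qed.

Let mixture0 : mixture set0 = 0.
Proof. by rewrite /mixture big1 // => j _; rewrite measure0 mule0. Qed.

Let mixture_ge0 B : 0 <= mixture B.
Proof. by apply: sume_ge0 => j _; rewrite mule_ge0 ?lee_fin. Qed.

Let mixture_sigma_additive : semi_sigma_additive mixture.
Proof.
move=> F mF tF mUF; rewrite [X in X @ _ --> _](_ : _ = fun n =>
    \sum_(j < d) (tnth (val p) j)%:E * \sum_(0 <= i < n) Q j (F i)); last first.
  apply/funext => n; rewrite /mixture exchange_big; apply: eq_bigr => j _.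
  by rewrite ge0_sume_distrr.
apply: cvg_nnesum => [j _|j _].
  by near=> n; rewrite mule_ge0 ?lee_fin ?sume_ge0.
by apply: cvgeZl => //; exact: measure_semi_sigma_additive.
Unshelve. all: by end_near. Qed.

HB.instance Definition _ := isMeasure.Build _ _ _ mixture
  mixture0 mixture_ge0 mixture_sigma_additive.

Let mixture_setT : mixture setT = 1.
Proof.
have /andP[_ /eqP p1] := valP p.
rewrite /mixture (eq_bigr (fun j => (tnth (val p) j)%:E)).
  by rewrite sumEFin p1.
by move=> j _; rewrite probability_setT mule1.
Qed.

HB.instance Definition _ :=
  Measure_isProbability.Build _ _ _ mixture mixture_setT.

End mixture.

Section iid.
Context (R : realType) (disp : measure_display) (T : measurableType disp).

Definition tuple_cons (m : nat) (x : T * m.-tuple T) : m.+1.-tuple T :=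
  [tuple of x.1 :: x.2].

Lemma measurable_tuple_cons (m : nat) : measurable_fun setT (@tuple_cons m).
Proof. exact: measurable_cons. Qed.

Section cons_law.
Local Open Scope ereal_scope.
Context (m : nat) (P : probability T R) (Pm : probability (m.-tuple T) R).

Definition cons_law : set (m.+1.-tuple T) -> \bar R :=
  pushforward (P \x Pm) (@tuple_cons m).

Let measurable_preimage A :
  measurable A -> measurable (@tuple_cons m @^-1` A).
Proof.
by move=> mA; rewrite -[X in measurable X]setTI; exact: measurable_tuple_cons.
Qed.

Let cons_law0 : cons_law set0 = 0.
Proof. by rewrite /cons_law /pushforward preimage_set0 measure0. Qed.

Let cons_law_ge0 A : 0 <= cons_law A.
Proof. by apply: integral_ge0 => x _ /=; exact: measure_ge0. Qed.

Let cons_law_sigma_additive : semi_sigma_additive cons_law.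
Proof.
move=> F mF tF mUF; rewrite /cons_law /pushforward preimage_bigcup.
apply: measure_semi_sigma_additive.
- by move=> i; exact: measurable_preimage.
- apply/trivIsetP => /= i j _ _ ij; rewrite -preimage_setI.
  by move/trivIsetP : tF => /(_ _ _ _ _ ij) ->//; rewrite preimage_set0.
- by rewrite -preimage_bigcup; exact: measurable_preimage.
Qed.

HB.instance Definition _ := isMeasure.Build _ _ _ cons_law
  cons_law0 cons_law_ge0 cons_law_sigma_additive.

Let cons_law_setT : cons_law setT = 1.
Proof.
rewrite /cons_law /pushforward preimage_setT -setXTT.
rewrite product_measure1E//.
by rewrite [X in X * _]probability_setT [X in _ * X]probability_setT mule1.
Qed.

HB.instance Definition _ :=
  Measure_isProbability.Build _ _ _ cons_law cons_law_setT.

End cons_law.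

(* The m-fold product measure of P on the product sigma-algebra of T^m. *)
Fixpoint iid_law (P : probability T R) (m : nat) : probability (m.-tuple T) R :=
  match m with
  | 0 => dirac [tuple]
  | m'.+1 => cons_law P (iid_law P m')
  end.

End iid.

(* n' = n (1 - epsilon); only used when the latter is an integer. *)
Definition nb_clean (R : realType) (n : nat) (eps : R) : nat :=
  Num.truncn (n%:R * (1 - eps)).

(* The families z of n batches for which {z_b : b \notin J} = {y_1, ..., y_n'}
   for some J of cardinality n eps: perm_eq compares collections, i.e. up to
   reordering and with multiplicities. *)
Definition contamination (R : realType) (disp : measure_display)
    (Z : measurableType disp) (n k : nat) (eps : R)
    (y : (nb_clean n eps).-tuple (k.-tuple Z)) : set (n.-tuple (k.-tuple Z)) :=
  [set z | exists J : {set 'I_n},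
     (#|J|%:R = n%:R * eps) /\ perm_eq [seq tnth z b | b <- enum (~: J)%SET] y].

Definition clean_law (R : realType) (disp : measure_display)
    (Z : measurableType disp) (d : nat) (n k : nat) (eps : R)
    (Q : 'I_d -> probability Z R) (p : simplex R d) :
    probability ((nb_clean n eps).-tuple (k.-tuple Z)) R :=
  iid_law (iid_law (mixture Q p) k) (nb_clean n eps).

Definition bad_event (R : realType) (disp : measure_display)
    (Z : measurableType disp) (d : nat) (n k : nat) (eps psi : R)
    (phat : n.-tuple (k.-tuple Z) -> simplex R d) (p : simplex R d) :
    set ((nb_clean n eps).-tuple (k.-tuple Z)) :=
  [set y | (psi%:E <
     ereal_sup [set (l1_dist (val (phat z)) (val p))%:E
               | z in contamination y])%E].

(* inf_{phat, Q} sup_p P_p(bad_event). The bad event involves a supremum over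
   an arbitrary, possibly uncountable, contamination set and need not be
   measurable: its probability is the outer probability mu_ext, which coincides
   with clean_law on measurable sets. The sigma-algebra of the simplex is the
   trace of the Borel one of R^d, so phat is measurable iff val \o phat is. *)
Definition minimax_risk (R : realType) (n k : nat) (alpha : R) (d : nat)
    (eps psi : R) : \bar R :=
  ereal_inf [set r : \bar R |
    exists (disp : measure_display) (Z : measurableType disp)
           (Q : 'I_d -> probability Z R)
           (phat : n.-tuple (k.-tuple Z) -> simplex R d),
      [/\ LDP alpha Q,
          measurable_fun [set: n.-tuple (k.-tuple Z)]
            (fun z => val (phat z) : d.-tuple R) &
          r = ereal_sup [set mu_ext (clean_law n k eps Q p)
                               (bad_event psi phat p)
                        | p in [set: simplex R d]]]].

Definition minimax_rate (R : realType) (delta : R) (n k : nat) (alpha : R)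
    (d : nat) (eps : R) : \bar R :=
  ereal_inf [set psi%:E | psi in
    [set psi : R | 0 < psi /\ (minimax_risk n k alpha d eps psi <= delta%:E)%E]].

(* Main.v *)
From mathcomp Require Import fingroup perm.
Require Import Defs.
From mathcomp Require Import measurable_realfun.
Import Order.TTheory GRing.Theory Num.Theory.
Import numFieldNormedType.Exports.
From mathcomp Require Import zify ring lra.
Set Implicit Arguments.
Unset Strict Implicit.
Unset Printing Implicit Defensive.
Local Open Scope classical_set_scope.
Local Open Scope ring_scope.

(** Both lower bounds are bounds on the chi-square divergence of private samples,
    and the upper bound is a union bound over all the directions and all the
    small sets of batches that an adversary could exploit.

    Lower bound. Local privacy forces the densities of the output laws to differ
    by at most 6 alpha ([LDP_densities]), so that a perturbation of the input
    distribution is seen only through a factor alpha. The sampling term comes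
    from Assouad's lemma over independent perturbations of the d / 2 pairs of
    entries of the uniform distribution ([sampling_lower_bound]). The
    contamination term comes from a two-point argument: signs of the
    perturbation are chosen to depend on the mechanism ([balanced_signs]) in such
    a way that one batch under the perturbed distribution is at total variation
    distance eps / 4 of one batch under the uniform one; an adversary who
    controls n eps batches can then produce the same data in both cases
    ([contamination_lower_bound]). Both closeness statements follow from the
    tensorization of [L2_dominated], and the adversary is analysed by
    [transport_duality_iid], which plays the role of an optimal coupling.

    Upper bound. The mechanism outputs a random vector of d signs with a bias of
    order alpha on the sign indexed by the input, so that each of the 2^d
    projections of the input distribution on a sign vector is the mean of a
    sub-Gaussian statistic ([mean_stat_mgf]), and the l1 norm is the maximum of
    these projections. With probability at least 1 - exp(- d), the centered
    statistics have small sums over the whole clean sample and over all its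
    subsets of at most n eps batches ([unstable_prob]). On this event, the true
    distribution is [compatible] with every contaminated sample, and any two
    compatible distributions are close ([compatible_close]) because they can be
    compared on the batches that neither of them discards. Any choice of a
    compatible distribution is therefore a good estimator. The factor
    sqrt(log(1/eps)) comes from the number of subsets of n eps batches among n.

    The probability level is exp(- d), which is at most 1/8 for d >= 3. *)

(** * Expectations of bounded functions *)

(** Bounded real-valued functions are integrable against every probability, so
    that expectations of them are real numbers and obey the usual algebra
    without side conditions on infinite values. *)
Definition bounded_measurable {R : realType} {disp} {T : measurableType disp}
    (g : T -> R) : Prop :=
  measurable_fun setT g /\ exists B : R, forall x, `|g x| <= B.

Definition mean {R : realType} {disp} {T : measurableType disp}
    (P : probability T R) (g : T -> R) : R := (\int[P]_x g x)%R.

Section mean.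
Context {R : realType} {disp} {T : measurableType disp}.
Implicit Types (P : probability T R) (g h : T -> R).

Lemma bm_cst (c : R) : bounded_measurable (fun _ : T => c).
Proof. by split; [exact: measurable_cst|exists `|c|]. Qed.

Lemma bmD g h : bounded_measurable g -> bounded_measurable h ->
  bounded_measurable (fun x => g x + h x).
Proof.
move=> [mg [B gB]] [mh [C hC]]; split; first exact: measurable_funD.
by exists (B + C) => x; rewrite (le_trans (ler_normD _ _))// lerD.
Qed.

Lemma bmM g h : bounded_measurable g -> bounded_measurable h ->
  bounded_measurable (fun x => g x * h x).
Proof.
move=> [mg [B gB]] [mh [C hC]]; split; first exact: measurable_funM.
by exists (B * C) => x; rewrite normrM ler_pM.
Qed.

Lemma bmZ (c : R) g : bounded_measurable g -> bounded_measurable (fun x => c * g x).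
Proof. by move=> bg; apply: bmM => //; exact: bm_cst. Qed.

Lemma bmN g : bounded_measurable g -> bounded_measurable (fun x => - g x).
Proof.
move=> /(bmZ (- 1)); congr bounded_measurable; apply/funext => x.
by rewrite mulN1r.
Qed.

Lemma bmB g h : bounded_measurable g -> bounded_measurable h ->
  bounded_measurable (fun x => g x - h x).
Proof. by move=> bg bh; apply: bmD => //; exact: bmN. Qed.

Lemma bm_sqr g : bounded_measurable g -> bounded_measurable (fun x => g x ^+ 2).
Proof. by move=> bg; exact: bmM. Qed.

Lemma bm_sum (I : Type) (s : seq I) (A : pred I) (g : I -> T -> R) :
  (forall i, bounded_measurable (g i)) ->
  bounded_measurable (fun x => \sum_(i <- s | A i) g i x).
Proof.
move=> bg; elim: s => [|i s ih].
  by under eq_fun do rewrite big_nil; exact: bm_cst.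
by under eq_fun do rewrite big_cons; case: (A i) => //; exact: bmD.
Qed.

Lemma bm_prod (I : Type) (s : seq I) (g : I -> T -> R) :
  (forall i, bounded_measurable (g i)) ->
  bounded_measurable (fun x => \prod_(i <- s) g i x).
Proof.
move=> bg; elim: s => [|i s ih].
  by under eq_fun do rewrite big_nil; exact: bm_cst.
by under eq_fun do rewrite big_cons; exact: bmM.
Qed.

Lemma bm_indic (A : set T) : measurable A -> bounded_measurable (\1_A : T -> R).
Proof.
move=> mA; split; first exact: measurable_indic.
by exists 1 => x; rewrite indicE; case: (_ \in _); rewrite ?normr1 ?normr0.
Qed.

Lemma bm_comp disp' (T' : measurableType disp') (f : T' -> T) g :
  measurable_fun setT f -> bounded_measurable g ->
  bounded_measurable (fun x => g (f x)).
Proof.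
move=> mf [mg [B gB]]; split; first exact: measurableT_comp.
by exists B.
Qed.

Lemma bm_integrable P g : bounded_measurable g -> P.-integrable setT (EFin \o g).
Proof.
move=> [mg [B gB]]; apply: measurable_bounded_integrable => //.
  by rewrite (le_lt_trans (probability_le1 _ _))// ltry.
exists B; split; first exact: num_real.
by move=> x Bx y _ /=; rewrite (le_trans (gB y))// ltW.
Qed.

Lemma meanE P g : bounded_measurable g -> (\int[P]_x (g x)%:E = (mean P g)%:E)%E.
Proof.
move=> bg; rewrite /mean /Rintegral fineK//.
exact/integrable_fin_num/bm_integrable.
Qed.

Lemma mean_cst P (c : R) : mean P (fun=> c) = c.
Proof.
by rewrite /mean Rintegral_cst//= probability_setT mulr1.
Qed.

Lemma meanD P g h : bounded_measurable g -> bounded_measurable h ->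
  mean P (fun x => g x + h x) = mean P g + mean P h.
Proof. by move=> bg bh; rewrite /mean RintegralD//; exact: bm_integrable. Qed.

Lemma meanZ P (c : R) g : bounded_measurable g ->
  mean P (fun x => c * g x) = c * mean P g.
Proof. by move=> bg; rewrite /mean RintegralZl//; exact: bm_integrable. Qed.

Lemma meanB P g h : bounded_measurable g -> bounded_measurable h ->
  mean P (fun x => g x - h x) = mean P g - mean P h.
Proof. by move=> bg bh; rewrite /mean RintegralB//; exact: bm_integrable. Qed.

Lemma mean_sum P (I : Type) (s : seq I) (A : pred I) (g : I -> T -> R) :
  (forall i, bounded_measurable (g i)) ->
  mean P (fun x => \sum_(i <- s | A i) g i x) = \sum_(i <- s | A i) mean P (g i).
Proof.
move=> bg; elim: s => [|i s ih].
  by under eq_fun do rewrite big_nil; rewrite mean_cst big_nil.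
rewrite big_cons; under eq_fun do rewrite big_cons.
by case: (A i) => //; rewrite meanD ?ih//; exact: bm_sum.
Qed.

Lemma le_mean P g h : bounded_measurable g -> bounded_measurable h ->
  (forall x, g x <= h x) -> mean P g <= mean P h.
Proof.
by move=> bg bh gh; apply: le_Rintegral => //; exact: bm_integrable.
Qed.

Lemma mean_ge0 P g : (forall x, 0 <= g x) -> 0 <= mean P g.
Proof. by move=> g0; apply: Rintegral_ge0. Qed.

Lemma mean_indic P (A : set T) : measurable A -> mean P \1_A = fine (P A).
Proof. by move=> mA; rewrite /mean /Rintegral integral_indic// setIT. Qed.

End mean.

Section mean_iid.
Context {R : realType} {disp} {T : measurableType disp}.
Implicit Types (P : probability T R).

Lemma bm_cons (m : nat) (g : m.+1.-tuple T -> R) : bounded_measurable g ->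
  bounded_measurable (g \o @tuple_cons disp T m).
Proof. by move=> bg; apply: bm_comp bg; exact: measurable_tuple_cons. Qed.

Lemma integrable_cons (m : nat) (P : probability T R)
    (Pm : probability (m.-tuple T) R) (g : m.+1.-tuple T -> R) :
  bounded_measurable g ->
  (P \x Pm)%E.-integrable setT (EFin \o (g \o @tuple_cons disp T m)).
Proof.
move=> /bm_cons[mg [B gB]]; apply: measurable_bounded_integrable => //.
  rewrite -[ltLHS]/(cons_law P Pm setT).
  by rewrite [ltLHS]probability_setT ltry.
exists B; split; first exact: num_real.
by move=> x Bx y _ /=; rewrite (le_trans (gB y))// ltW.
Qed.

Lemma bm_cons_section (m : nat) (g : m.+1.-tuple T -> R) (x : T) :
  bounded_measurable g -> bounded_measurable (fun y => g (tuple_cons (x, y))).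
Proof. by move=> /bm_cons bg; apply: bm_comp bg; exact: pair1_measurable. Qed.

(** Measurability of the section integrals comes from Fubini's theorem on the
    product of [P] and [Pm], where [g] is integrable since it is bounded. *)
Lemma bm_cons_mean (m : nat) (P : probability T R) (Pm : probability (m.-tuple T) R)
    (g : m.+1.-tuple T -> R) :
  bounded_measurable g ->
  bounded_measurable (fun x => mean Pm (fun y => g (tuple_cons (x, y)))).
Proof.
move=> bg; have [mg [B gB]] := bg; split; last first.
  exists B => x; rewrite ler_norml; apply/andP; split.
    rewrite -(mean_cst Pm (- B)); apply: le_mean => //.
    - exact: bm_cst.
    - exact: bm_cons_section.
    - by move=> y; have := gB (tuple_cons (x, y)); rewrite ler_norml => /andP[].
  rewrite -[leRHS](mean_cst Pm B); apply: le_mean => //.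
  - exact: bm_cons_section.
  - exact: bm_cst.
  - by move=> y; have := gB (tuple_cons (x, y)); rewrite ler_norml => /andP[].
apply/measurable_EFinP.
pose f (z : T * m.-tuple T) := (EFin \o (g \o @tuple_cons disp T m)) z.
have mf : measurable_fun setT f.
  by apply/measurable_EFinP; have [] := bm_cons bg.
rewrite (_ : _ \o _ = fubini_F Pm f); last first.
  by apply/funext => x; rewrite /= -meanE//; exact: bm_cons_section.
exact: (measurable_fubini_F (integrable_cons P Pm bg)).
Qed.

(** Fubini's theorem for one more independent observation; it turns every
    statement on i.i.d. samples below into an induction on the sample size. *)
Lemma mean_cons (m : nat) (P : probability T R) (Pm : probability (m.-tuple T) R)
    (g : m.+1.-tuple T -> R) :
  bounded_measurable g ->
  mean (cons_law P Pm) g =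
  mean P (fun x => mean Pm (fun y => g (tuple_cons (x, y)))).
Proof.
move=> bg; rewrite {1}/mean /Rintegral.
have -> : (\int[cons_law P Pm]_x (g x)%:E =
   \int[pushforward (P \x Pm) (@tuple_cons disp T m)]_x (g x)%:E)%E.
  by [].
have mc : measurable_fun setT (EFin \o (g \o @tuple_cons disp T m)).
  by apply/measurable_EFinP; have [] := bm_cons bg.
have ic := integrable_cons P Pm bg.
rewrite integral_pushforward//=.
- rewrite preimage_setT -integral12_prod_meas1//.
  rewrite /mean /Rintegral; congr fine; apply: eq_integral => x _.
  by rewrite /fubini_F /= meanE//; exact: bm_cons_section.
- exact: measurable_tuple_cons.
- by apply/measurable_EFinP; have [] := bg.
Qed.

End mean_iid.

Arguments bm_cons_mean {R disp T m} P Pm [g].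

Section iid_products.
Context {R : realType} {disp} {T : measurableType disp}.
Implicit Types (P : probability T R).

Lemma mean_iid0 P (g : 0.-tuple T -> R) : mean (iid_law P 0) g = g [tuple].
Proof.
rewrite (_ : g = fun=> g [tuple]); last by apply/funext => y; rewrite tuple0.
exact: mean_cst.
Qed.

Lemma mean_iidS P (m : nat) (g : m.+1.-tuple T -> R) : bounded_measurable g ->
  mean (iid_law P m.+1) g =
  mean P (fun x => mean (iid_law P m) (fun y => g (tuple_cons (x, y)))).
Proof. exact: mean_cons. Qed.

Lemma tnth_tuple_cons0 (m : nat) (x : T * m.-tuple T) :
  tnth (tuple_cons x) ord0 = x.1.
Proof. by []. Qed.

Lemma tnth_tuple_consS (m : nat) (x : T * m.-tuple T) (i : 'I_m) :
  tnth (tuple_cons x) (lift ord0 i) = tnth x.2 i.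
Proof. exact: tnthS. Qed.

Lemma bm_tnth (m : nat) (i : 'I_m) (g : T -> R) : bounded_measurable g ->
  bounded_measurable (fun y : m.-tuple T => g (tnth y i)).
Proof. by move=> bg; apply: bm_comp bg; exact: measurable_tnth. Qed.

Lemma mean_iid_prod P (m : nat) (f : 'I_m -> T -> R) :
  (forall i, bounded_measurable (f i)) ->
  mean (iid_law P m) (fun y => \prod_(i < m) f i (tnth y i)) =
  \prod_(i < m) mean P (f i).
Proof.
elim: m f => [|m ih] f bf; first by rewrite mean_iid0 !big_ord0.
rewrite mean_iidS; last by apply: bm_prod => i; exact: bm_tnth.
rewrite big_ord_recl -ih//.
transitivity (mean P (fun x =>
    mean (iid_law P m) (fun y => \prod_(i < m) f (lift ord0 i) (tnth y i))
    * f ord0 x)); last by rewrite meanZ// mulrC.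
congr mean; apply/funext => x; rewrite mulrC -meanZ; last first.
  by apply: bm_prod => i; exact: bm_tnth.
congr mean; apply/funext => y; rewrite big_ord_recl tnth_tuple_cons0.
by under eq_bigr do rewrite tnth_tuple_consS.
Qed.

End iid_products.

(** * Chi-square domination and its tensorization *)

Section L2_domination.
Context {R : realType} {disp} {T : measurableType disp}.
Implicit Types (P : probability T R).

(** When [nu] has a density with respect to [mu], the smallest [K] is one plus
    the chi-square divergence of [nu] from [mu]. Stating it through test
    functions makes it tensorize without manipulating densities on products. *)
Definition L2_dominated (K : R) (mu nu : probability T R) : Prop :=
  forall g : T -> R, bounded_measurable g ->
    mean nu g ^+ 2 <= K * mean mu (fun x => g x ^+ 2).

Lemma L2_dominatedW (mu nu : probability T R) (K K' : R) :
  K <= K' -> L2_dominated K mu nu -> L2_dominated K' mu nu.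
Proof.
move=> KK' dom g bg; rewrite (le_trans (dom g bg))// ler_wpM2r//.
by apply: mean_ge0 => x; exact: sqr_ge0.
Qed.

(** The mean of (s f + t g)^2 is nonnegative; take s = c and t = - b, where b is
    the mean of f g and c the mean of g^2. The case c = 0 is treated apart. *)
Lemma mean_Cauchy_Schwarz P (f g : T -> R) :
  bounded_measurable f -> bounded_measurable g ->
  mean P (fun x => f x * g x) ^+ 2 <=
  mean P (fun x => f x ^+ 2) * mean P (fun x => g x ^+ 2).
Proof.
move=> bf bg.
set a := mean P (fun x => f x ^+ 2); set b := mean P (fun x => f x * g x).
set c := mean P (fun x => g x ^+ 2).
have q s t : 0 <= s ^+ 2 * a + 2 * (s * t) * b + t ^+ 2 * c.
  have := @mean_ge0 _ _ _ P (fun x => (s * f x + t * g x) ^+ 2).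
  rewrite (_ : (fun x => _) = (fun x => s ^+ 2 * f x ^+ 2 +
     2 * (s * t) * (f x * g x) + t ^+ 2 * g x ^+ 2)); last first.
    by apply/funext => x; ring.
  rewrite !meanD ?meanZ; first (by apply => x; exact: sqr_ge0);
    by do ?[apply: bm_sqr|apply: bmM|apply: bmD|exact: bm_cst].
have a0 : 0 <= a by apply: mean_ge0 => x; exact: sqr_ge0.
have c0 : 0 <= c by apply: mean_ge0 => x; exact: sqr_ge0.
have [c00|cN0] := eqVneq c 0.
  have [->|bN0] := eqVneq b 0; first by rewrite expr0n mulr_ge0.
  pose t := - (a + 1) / (2 * b).
  have tE : 1 ^+ 2 * a + 2 * (1 * t) * b + t ^+ 2 * c = - 1.
    by rewrite c00 /t; field.
  by have := q 1 t; rewrite tE oppr_ge0 ler10.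
have qE : c ^+ 2 * a + 2 * (c * - b) * b + (- b) ^+ 2 * c = c * (a * c - b ^+ 2).
  by ring.
have := q c (- b); rewrite qE.
by rewrite pmulr_rge0 ?lt_def ?cN0// subr_ge0.
Qed.

(** Cauchy-Schwarz applied to g and 1 + h; the perturbation h has mean zero since
    both measures have mass one, so (1 + h)^2 has mean 1 + v at most. *)
Lemma L2_dominated_density (mu nu : probability T R) (h : T -> R) (v : R) :
  bounded_measurable h ->
  (forall g, bounded_measurable g ->
     mean nu g = mean mu (fun x => g x * (1 + h x))) ->
  mean mu (fun x => h x ^+ 2) <= v ->
  L2_dominated (1 + v) mu nu.
Proof.
move=> bh hE hv g bg; have b1 : bounded_measurable (fun _ : T => 1 : R).
  exact: bm_cst.
have h0 : mean mu h = 0.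
  have := hE (fun=> 1) b1; rewrite mean_cst.
  under eq_fun do rewrite mul1r.
  by rewrite meanD// mean_cst => /eqP; rewrite addrC -subr_eq subrr eq_sym => /eqP.
rewrite hE// (le_trans (mean_Cauchy_Schwarz _ _ _))//; first exact: bmD.
rewrite mulrC ler_wpM2r//; first by apply: mean_ge0 => x; exact: sqr_ge0.
rewrite (_ : (fun x => _) = (fun x => 1 + 2 * h x + h x ^+ 2)); last first.
  by apply/funext => x; ring.
by rewrite !meanD ?meanZ ?mean_cst ?h0 ?mulr0 ?addr0 ?lerD2l//;
    do ?[apply: bm_sqr|apply: bmM|apply: bmD|exact: bm_cst].
Qed.

(** Total variation is at most the square root of the chi-square divergence.
    The domination hypothesis is used for the translates g - m + t, where m is
    the mean of g, and the optimal translation is t = x / v^2 for a difference x of means. *)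
Lemma L2_dominated_mean_close (v : R) (mu nu : probability T R) (g : T -> R) :
  0 < v -> L2_dominated (1 + v ^+ 2) mu nu -> bounded_measurable g ->
  (forall x, 0 <= g x <= 1) -> `|mean nu g - mean mu g| <= v.
Proof.
move=> v0 dom bg g01; set m := mean mu g; set x := mean nu g - m.
have bgm : bounded_measurable (fun y => g y - m) by apply: bmB => //; exact: bm_cst.
have m01 : 0 <= m <= 1.
  apply/andP; split; first by apply: mean_ge0 => y; case/andP: (g01 y).
  rewrite -(mean_cst mu 1); apply: le_mean => //; first exact: bm_cst.
  by move=> y; case/andP: (g01 y).
pose s := mean mu (fun y => (g y - m) ^+ 2).
have s1 : s <= 1.
  rewrite -(mean_cst mu 1); apply: le_mean; [exact: bm_sqr|exact: bm_cst|].
  move=> y; have /andP[gy0 gy1] := g01 y; have /andP[m0 m1] := m01.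
  have -> : (g y - m) ^+ 2 = 1 - (1 - (g y - m)) * (1 + (g y - m)) by ring.
  by rewrite gerBl mulr_ge0//; lra.
have key t : (x + t) ^+ 2 <= (1 + v ^+ 2) * (s + t ^+ 2).
  have := dom (fun y => (g y - m) + t).
  rewrite meanD ?meanB ?mean_cst; try by [exact: bm_cst|].
  rewrite (_ : (fun x => _ ^+ 2) = (fun y => (g y - m) ^+ 2 +
     2 * t * (g y - m) + t ^+ 2)); last by apply/funext => y; ring.
  rewrite !meanD ?meanZ ?meanB ?mean_cst ?subrr ?mulr0 ?addr0 //;
    try by do ?[apply: bm_sqr|apply: bmM|apply: bmD|apply: bmB|exact: bm_cst].
  by apply; apply: bmD => //; exact: bm_cst.
rewrite -(@ler_pXn2r _ 2)// ?nnegrE ?(ltW v0)// real_normK ?num_real//.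
have v20 : 0 < v ^+ 2 by exact: exprn_gt0.
set w := v ^+ 2 in key v20 *.
have := key (x / w).
have -> : (x + x / w) ^+ 2 = (x ^+ 2 * (1 + w)) * ((1 + w) / w ^+ 2).
  by field; rewrite gt_eqF.
have -> : (1 + w) * (s + (x / w) ^+ 2) = (s * w ^+ 2 + x ^+ 2) * ((1 + w) / w ^+ 2).
  by field; rewrite gt_eqF.
rewrite ler_pM2r; last by rewrite divr_gt0 ?exprn_gt0// ltr_wpDl.
move=> H; have : x ^+ 2 * w <= s * w ^+ 2 by lra.
rewrite (_ : s * w ^+ 2 = s * w * w); last by ring.
by rewrite ler_pM2r// => /le_trans; apply; rewrite ler_piMl// ltW.
Qed.

End L2_domination.

Section tensorization.
Context {R : realType} {disp} {T : measurableType disp}.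

(** Integrate out one coordinate at a time: the domination by [K] for the first
    coordinate is applied to the mean over the others. *)
Lemma L2_dominated_iid (K : R) (mu nu : probability T R) (m : nat) :
  0 <= K -> L2_dominated K mu nu ->
  L2_dominated (K ^+ m) (iid_law mu m) (iid_law nu m).
Proof.
move=> K0 dom; elim: m => [|m ih] g bg.
  by rewrite !mean_iid0 expr0 mul1r.
have bg2 := bm_sqr bg.
have bgn := bm_cons_mean mu (iid_law nu m) bg.
have bgm := bm_cons_mean mu (iid_law mu m) bg2.
rewrite !mean_iidS//; apply: le_trans (dom _ bgn) _.
rewrite exprS -mulrA ler_wpM2l// -meanZ//.
apply: le_mean; [exact: bm_sqr|exact: bmZ|] => x.
by apply: (ih (fun y => g (tuple_cons (x, y)))); exact: bm_cons_section.
Qed.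

End tensorization.

(** * Bounded densities and a dual form of coupling *)

Section density.
Context {R : realType} {disp} {T : measurableType disp}.

(** The integral over the set where the function is positive is both
    nonnegative and nonpositive. *)
Lemma ae_le0_integral (mu : {measure set T -> \bar R}) (H : T -> \bar R) :
  mu.-integrable setT H ->
  (forall A, measurable A -> (\int[mu]_(x in A) H x <= 0)%E) ->
  {ae mu, forall x, (H x <= 0)%E}.
Proof.
move=> iH H0; have mH := measurable_int _ iH.
pose A := [set x | (0 < H x)%E].
have mA : measurable A by rewrite -[A]setTI; exact: emeasurable_fun_o_infty.
have HA0 : (\int[mu]_(x in A) `|H x| = 0)%E.
  apply/eqP; rewrite eq_le integral_ge0 ?andbT//.
  rewrite (eq_integral H) ?H0// => x; rewrite inE => Ax.
  by rewrite gee0_abs// ltW.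
have /ae_eq_integral_abs : measurable_fun A H by exact: measurable_funTS.
move=> /(_ mu mA)[/(_ HA0) + _]; apply: filterS => x /= AH.
by rewrite leNgt; apply/negP => Hx; move: (Hx); rewrite (AH Hx) ltxx.
Qed.

(** A Radon-Nikodym derivative satisfies the bounds almost everywhere only;
    truncating it makes them hold everywhere without changing any integral. *)
Lemma bounded_density (P mu : probability T R) (a b : R) : a <= b ->
  (forall B, measurable B -> (a%:E * mu B <= P B)%E) ->
  (forall B, measurable B -> (P B <= b%:E * mu B)%E) ->
  exists f : T -> R, [/\ measurable_fun setT f, forall x, a <= f x <= b &
    forall g, bounded_measurable g -> mean P g = mean mu (fun x => g x * f x)].
Proof.
move=> ab aP Pb.
have dom : P `<< mu.
  apply/null_content_dominatesP => B mB B0; apply/eqP.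
  by rewrite eq_le measure_ge0 andbT (le_trans (Pb _ mB))// B0 mule0.
pose F := Radon_Nikodym (charge_of_finite_measure P) mu.
have FE B : measurable B -> P B = (\int[mu]_(x in B) F x)%E.
  by move=> mB; rewrite -Radon_Nikodym_integral.
have iF : mu.-integrable setT F by exact: Radon_Nikodym_integrable.
have Ff x : F x \is a fin_num by exact: Radon_Nikodym_fin_num.
have mF := measurable_int _ iF.
have ic (c : R) : mu.-integrable setT (cst c%:E).
  exact: (bm_integrable _ (bm_cst c)).
have cE (c : R) B : measurable B -> (\int[mu]_(x in B) cst c%:E x = c%:E * mu B)%E.
  by move=> mB; rewrite integral_cst.
have Fb : {ae mu, forall x, (F x - b%:E <= 0)%E}.
  apply: (@ae_le0_integral mu (F \- cst b%:E)%E); first exact: integrableB.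
  move=> B mB; rewrite integralB//; first by rewrite -FE// cE// sube_le0 Pb.
    exact: integrableS iF.
  exact: integrableS (ic b).
have Fa : {ae mu, forall x, (a%:E - F x <= 0)%E}.
  apply: (@ae_le0_integral mu (cst a%:E \- F)%E); first exact: integrableB.
  move=> B mB; rewrite integralB//; first by rewrite -FE// cE// sube_le0 aP.
    exact: integrableS (ic a).
  exact: integrableS iF.
pose f x := Num.max a (Num.min b (fine (F x))).
have mf : measurable_fun setT f.
  apply: measurable_maxr => //; apply: measurable_minr => //.
  exact/measurableT_comp.
have fab x : a <= f x <= b by rewrite /f le_max ge_max lexx/= ab ge_min lexx.
have bf : bounded_measurable f.
  split=> //; exists (`|a| + `|b|) => x; have /andP[fa fb] := fab x.
  rewrite ler_norml; have := ler_norm b; have := ler_norm (- a); rewrite normrN.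
  by move=> ? ?; apply/andP; split; have := normr_ge0 a; have := normr_ge0 b; lra.
exists f; split=> // g bg.
rewrite /mean /Rintegral; congr fine.
have ig := bm_integrable P bg.
rewrite -(Radon_Nikodym_change_of_variables dom measurableT ig) -/F.
apply: ae_eq_integral => //.
- by apply: emeasurable_funM => //; apply/measurable_EFinP; have [] := bg.
- by apply/measurable_EFinP; have [] := bmM bg bf.
apply: filterS2 Fa Fb => x; rewrite sube_le0 sube_le0 => Fxa Fxb _ /=.
rewrite EFinM; congr (_ * _)%E; rewrite -[LHS]fineK// /f; congr (_%:E).
move: Fxa Fxb; rewrite -[F x]fineK// !lee_fin => Fxa Fxb /=.
by rewrite min_r// max_r.
Qed.

End density.

Section duality.
Context {R : realType} {disp} {T : measurableType disp}.

(** The easy half of Kantorovich duality for the cost of being different,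
    without any coupling. If i is the infimum of F, then F can be replaced by
    the smaller function F1 = min(F, i + b), whose values lie in an interval
    of length b, while the hypothesis still gives G >= a - F1. It remains to
    compare the means of F1 under the two laws. *)
Lemma transport_duality (M V : probability T R) (t a b : R) (F G : T -> R) :
  0 < b -> (forall g, bounded_measurable g -> (forall x, 0 <= g x <= 1) ->
    `|mean V g - mean M g| <= t) ->
  bounded_measurable F -> bounded_measurable G ->
  (forall x x', a - b * (x != x')%:R <= F x + G x') ->
  a - b * t <= mean M F + mean V G.
Proof.
move=> b0 MVt bF bG FG.
pose i := inf [set F x | x in setT].
have iF x : i <= F x.
  apply: ge_inf; last by exists x.
  have [_ [B FB]] := bF; exists (- B) => _ [y _ <-].
  by have := FB y; rewrite ler_norml => /andP[].
have bi : bounded_measurable (fun _ : T => i) by exact: bm_cst.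
pose F1 x := Num.min (F x) (i + b).
have bF1 : bounded_measurable F1.
  have [mF [B FB]] := bF; split; first exact: measurable_minr.
  exists (`|i| + b) => x; have := iF x; rewrite /F1 ler_norml.
  have := ler_norm i; have := ler_norm (- i); rewrite normrN => ? ? ?.
  by case: (leP (F x) (i + b)) => ?; apply/andP; split; lra.
have FG1 x : a - F1 x <= G x.
  have := FG x x; rewrite eqxx mulr0 subr0 /F1 => FGx.
  case: (leP (F x) (i + b)) => _; first lra.
  suff : a - b - G x <= i by lra.
  apply: lb_le_inf; first by exists (F x); exists x.
  move=> _ [y _ <-]; have := FG y x.
  have := ler_piMr (ltW b0) (_ : (y != x)%:R <= 1 :> R).
  by rewrite lern1 leq_b1 => /(_ isT); lra.
pose g x := b^-1 * (F1 x - i).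
have bg : bounded_measurable g by apply: bmZ; exact: bmB.
have g01 x : 0 <= g x <= 1.
  rewrite /g pmulr_rge0 ?invr_gt0// mulrC ler_pdivrMr// mul1r /F1.
  by have := iF x; case: (leP (F x) (i + b)) => ? ?; apply/andP; split; lra.
have := MVt g bg g01; rewrite !meanZ ?meanB ?mean_cst//; last exact: bmB.
  2: exact: bmB.
rewrite ler_norml => /andP[_]; rewrite -mulrBr mulrC ler_pdivrMr// => H.
have H1 : mean M F1 <= mean M F by apply: le_mean => // x; rewrite ge_min lexx.
have H2 : a - mean V F1 <= mean V G.
  rewrite -[X in X - _](mean_cst V a) -meanB//; last exact: bm_cst.
  by apply: le_mean => //; apply: bmB => //; exact: bm_cst.
by lra.
Qed.

Definition hamming (m : nat) (y y' : m.-tuple T) : nat :=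
  \sum_(i < m) (tnth y i != tnth y' i).

(** If both laws are t-close, n-samples of them can be coupled so as to differ
    in n t places on average. This is the dual consequence of that fact for
    the Hamming cost, obtained by induction from the one-coordinate case. *)
Lemma transport_duality_iid (M V : probability T R) (t b : R) :
  0 < b -> (forall g, bounded_measurable g -> (forall x, 0 <= g x <= 1) ->
    `|mean V g - mean M g| <= t) ->
  forall (m : nat) (a : R) (F G : m.-tuple T -> R),
  bounded_measurable F -> bounded_measurable G ->
  (forall y y', a - b * (hamming y y')%:R <= F y + G y') ->
  a - b * (m%:R * t) <= mean (iid_law M m) F + mean (iid_law V m) G.
Proof.
move=> b0 MVt; elim=> [|m ih] a F G bF bG FG.
  rewrite !mean_iid0 mul0r; have := FG [tuple] [tuple].
  by rewrite /hamming big_ord0.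
rewrite !mean_iidS//.
rewrite (_ : a - _ = (a - b * (m%:R * t)) - b * t); last by rewrite -natr1; ring.
apply: transport_duality => //; [exact: bm_cons_mean M _ _ bF|exact: bm_cons_mean M _ _ bG|].
move=> x x'.
rewrite (_ : _ - _ = (a - b * (x != x')%:R) - b * (m%:R * t)); last by ring.
apply: ih; [exact: bm_cons_section|exact: bm_cons_section|].
move=> y y'; apply: le_trans (FG _ _).
rewrite /hamming big_ord_recl !tnth_tuple_cons0 natrD mulrDr opprD addrA.
by under [in leRHS]eq_bigr do rewrite !tnth_tuple_consS.
Qed.

End duality.

(** * Mixtures and local privacy *)

Section mixture_mean.
Context {R : realType} {disp} {Z : measurableType disp} {d : nat}.
Implicit Types (Q : 'I_d -> probability Z R) (p : simplex R d).

Lemma simplex_ge0 p j : 0 <= tnth (val p) j.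
Proof. by have /andP[/forallP] := valP p. Qed.

Lemma simplex_sum1 p : \sum_(j < d) tnth (val p) j = 1.
Proof. by have /andP[_ /eqP] := valP p. Qed.

(** The mixture is a finite sum of scaled measures, for which integrals are
    additive on nonnegative functions; a bounded function becomes nonnegative
    after adding a constant. *)
Lemma mean_mixture Q p (g : Z -> R) : bounded_measurable g ->
  mean (mixture Q p) g = \sum_(j < d) tnth (val p) j * mean (Q j) g.
Proof.
wlog g0 : g / forall x, 0 <= g x => [hwlog|] bg.
  have [mg [B gB]] := bg.
  have bgB : bounded_measurable (fun x => g x + B) by apply: bmD => //; exact: bm_cst.
  have /hwlog/(_ bgB) : forall x, 0 <= g x + B.
    by move=> x; have := gB x; rewrite ler_norml => /andP[]; lra.
  rewrite meanD ?mean_cst//; last exact: bm_cst.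
  rewrite (eq_bigr (fun j => tnth (val p) j * mean (Q j) g + tnth (val p) j * B)).
    by rewrite big_split/= -mulr_suml simplex_sum1 mul1r => /addIr.
  by move=> j _; rewrite meanD ?mean_cst ?mulrDr//; exact: bm_cst.
have [mg _] := bg.
pose m_ (k : nat) : {measure set Z -> \bar R} :=
  if insub k is Some j then mscale (NngNum (simplex_ge0 p j)) (Q j) else mzero.
apply: EFin_inj; rewrite -meanE//.
rewrite (eq_measure_integral (msum m_ d)); last first.
  move=> B mB _; rewrite /= /mixture /msum; apply: eq_bigr => j _.
  by rewrite /m_ valK.
have g0' x : setT x -> (0 <= (g x)%:E)%E by rewrite lee_fin.
have mg' : measurable_fun setT (EFin \o g) by exact/measurable_EFinP.
rewrite ge0_integral_measure_sum//.
rewrite -sumEFin; apply: eq_bigr => j _.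
rewrite /m_ valK ge0_integral_mscale//.
by rewrite EFinM -meanE.
Qed.

End mixture_mean.

Section LDP.
Context {R : realType} {disp} {Z : measurableType disp} {d : nat}.
Context (alpha : R) (Q : 'I_d -> probability Z R).

Let lee_divE (P P' : probability Z R) (r : R) B :
  measurable B -> P' B != 0%E -> (P B / P' B <= r%:E)%E = (P B <= r%:E * P' B)%E.
Proof.
move=> mB P0; have fP : P' B \is a fin_num by exact: fin_num_measure.
have r0 : 0 < fine (P' B) by rewrite fine_gt0// ltey_eq fP lt0e P0 measure_ge0.
by rewrite -[P' B in LHS]fineK// inver gt_eqF// lee_pdivrMr// fineK.
Qed.

(** When [Q x' B] vanishes, so does [Q x B]: the quotient would otherwise be
    infinite. *)
Lemma LDP_le : LDP alpha Q -> forall x x' B, measurable B ->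
  (Q x B <= (expR alpha)%:E * Q x' B)%E.
Proof.
move=> ldp x x' B mB.
have : (Q x B / Q x' B <= (expR alpha)%:E)%E.
  apply: le_trans ldp; apply: le_trans (ereal_sup_ubound _); last first.
    by exists B.
  by apply: ereal_sup_ubound; exists x => //; exists x'.
have [Q0|Q0] := eqVneq (Q x' B) 0%E.
  rewrite Q0 inve0 mule0; have [->|Qx0] := eqVneq (Q x B) 0%E; first by [].
  by rewrite gt0_muley ?leye_eq// lt0e Qx0 measure_ge0.
by rewrite lee_divE.
Qed.

Lemma le_LDP : (forall x x' B, measurable B ->
  (Q x B <= (expR alpha)%:E * Q x' B)%E) -> LDP alpha Q.
Proof.
move=> H; apply: ge_ereal_sup => _ [B mB <-].
apply: ge_ereal_sup => _ [x _ [x' _ <-]].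
have [Q0|Q0] := eqVneq (Q x' B) 0%E.
  have := H x x' B mB; rewrite Q0 mule0 => Qx0.
  have -> : Q x B = 0%E by apply/eqP; rewrite eq_le Qx0 measure_ge0.
  by rewrite mul0e lee_fin expR_ge0.
by rewrite lee_divE//; exact: H.
Qed.

End LDP.

Section LDP_density.
Context {R : realType} {disp} {Z : measurableType disp} {d : nat}.
Context (alpha : R) (Q : 'I_d -> probability Z R) (p : simplex R d).
Hypothesis ldp : LDP alpha Q.

Lemma LDP_mixture_le i B : measurable B ->
  (Q i B <= (expR alpha)%:E * mixture Q p B)%E.
Proof.
move=> mB; rewrite /mixture ge0_sume_distrr//; last first.
  by move=> j _; rewrite mule_ge0 ?lee_fin ?simplex_ge0.
rewrite -[leLHS]mul1e -(simplex_sum1 p) -sumEFin ge0_sume_distrl; last first.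
  by move=> j _; rewrite lee_fin simplex_ge0.
apply: lee_sum => j _; rewrite muleCA lee_wpmul2l ?lee_fin ?simplex_ge0//.
exact: LDP_le.
Qed.

Lemma LDP_mixture_ge i B : measurable B ->
  ((expR (- alpha))%:E * mixture Q p B <= Q i B)%E.
Proof.
move=> mB; rewrite /mixture ge0_sume_distrr//; last first.
  by move=> j _; rewrite mule_ge0 ?lee_fin ?simplex_ge0.
rewrite -[leRHS]mul1e -(simplex_sum1 p) -sumEFin ge0_sume_distrl; last first.
  by move=> j _; rewrite lee_fin simplex_ge0.
apply: lee_sum => j _; rewrite muleCA lee_wpmul2l ?lee_fin ?simplex_ge0//.
apply: (@le_trans _ _ ((expR (- alpha))%:E * ((expR alpha)%:E * Q i B))%E).
  by rewrite lee_wpmul2l ?lee_fin ?expR_ge0//; exact: LDP_le.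
by rewrite muleA -EFinM -expRD addNr expR0 mul1e.
Qed.

(** Privacy bounds all the densities with respect to a mixture between
    exp(- alpha) and exp(alpha). These bounds differ by at most 6 alpha for
    alpha < 1, which is where the factor alpha of the rates comes from. *)
Lemma LDP_densities : 0 < alpha < 1 -> exists f : 'I_d -> Z -> R,
  [/\ forall i, bounded_measurable (f i),
      forall i j z, `|f i z - f j z| <= 6 * alpha &
      forall i g, bounded_measurable g ->
        mean (Q i) g = mean (mixture Q p) (fun z => g z * f i z)].
Proof.
move=> /andP[a0 a1].
have aa : expR (- alpha) <= expR alpha by rewrite ler_expR; lra.
pose S i := bounded_density aa (fun B => @LDP_mixture_ge i B) (fun B => @LDP_mixture_le i B).
exists (fun i => sval (cid (S i))); split=> [i|i j z|i g].
- case: cid => /= f [mf fab _]; split=> //; exists (expR alpha) => z.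
  by have /andP[] := fab z; have := expR_gt0 (- alpha); rewrite ler_norml => ? ? ->; lra.
- case: cid => /= f [_ fab _]; case: cid => /= f' [_ fab' _].
  have /andP[f1 f2] := fab z; have /andP[f1' f2'] := fab' z.
  have e1 : 1 - alpha <= expR (- alpha) by exact: expR_ge1Dx.
  have e2 : expR alpha <= 1 + 3 * alpha.
    have : 1 - alpha / 2 <= expR (- (alpha / 2)) by exact: expR_ge1Dx.
    have : expR (alpha / 2) * expR (- (alpha / 2)) = 1 by rewrite -expRD subrr expR0.
    have -> : expR alpha = expR (alpha / 2) ^+ 2.
      by rewrite expr2 -expRD; congr expR; lra.
    have := expR_gt0 (alpha / 2).
    set s := expR (alpha / 2); set t := expR _ => s0 st t1.
    have st1 : s * (1 - alpha / 2) <= 1 by rewrite -[leRHS]st ler_wpM2l// ltW.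
    have s2 : s ^+ 2 * (1 - alpha / 2) ^+ 2 <= 1.
      by rewrite -exprMn expr_le1// mulr_ge0; lra.
    have : 1 <= (1 + 3 * alpha) * (1 - alpha / 2) ^+ 2.
      rewrite -subr_ge0 (_ : _ - 1 = alpha * (1 - alpha) * (2 - 3 / 4 * alpha)).
        by apply: mulr_ge0; [apply: mulr_ge0|]; lra.
      by field.
    move=> /(le_trans s2); rewrite ler_pM2r// exprn_gt0//; lra.
  by rewrite ler_norml; apply/andP; split; lra.
- by case: cid => /= f [_ _ fE] bg; exact: fE.
Qed.

End LDP_density.

(** * Paired perturbations of the uniform distribution *)

Section perturbation.
Context {R : realType} {d : nat}.
Implicit Types (i : 'I_d) (j : 'I_(d./2)) (v : 'I_(d./2) -> R).

Fact lo_subproof j : (j.*2 < d)%N.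
Proof. by have := ltn_ord j; lia. Qed.

Fact hi_subproof j : (j.*2.+1 < d)%N.
Proof. by have := ltn_ord j; lia. Qed.

Definition lo j : 'I_d := Ordinal (lo_subproof j).
Definition hi j : 'I_d := Ordinal (hi_subproof j).

(** The signed measure that moves mass from the second to the first element of
    the j-th pair {2 j, 2 j + 1}. *)
Definition dipole j i : R := (i == lo j)%:R - (i == hi j)%:R.

Lemma sum_dipole j (x : 'I_d -> R) :
  \sum_i dipole j i * x i = x (lo j) - x (hi j).
Proof.
under eq_bigr do rewrite mulrBl !mulr_natl.
rewrite big_split/= sumrN; congr (_ - _).
  by rewrite -(big_pred1_eq +%R (lo j)) [RHS]big_mkcond; apply: eq_bigr => i _;
    case: eqP.
by rewrite -(big_pred1_eq +%R (hi j)) [RHS]big_mkcond; apply: eq_bigr => i _;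
    case: eqP.
Qed.

Lemma norm_dipole j i : `|dipole j i| = (i./2 == j)%:R.
Proof.
rewrite /dipole -!val_eqE/=.
case: (eqVneq (i : nat) j.*2) => [->|n1].
  rewrite doubleK eqxx (_ : (_ == _) = false) ?subr0 ?normr1//; lia.
case: (eqVneq (i : nat) j.*2.+1) => [->|n2].
  by rewrite /= uphalf_double eqxx sub0r normrN normr1.
rewrite subrr normr0 (_ : (_ == _) = false)//; apply/eqP => ij.
by move: n1 n2; have := odd_double_half i; rewrite ij; case: odd; lia.
Qed.

Lemma sum_norm_dipole i : \sum_j `|dipole j i| <= 1.
Proof.
under eq_bigr do rewrite norm_dipole.
have [lti|gei] := ltnP i./2 d./2; last first.
  rewrite big1 ?ler01// => j _; rewrite (_ : (_ == _) = false)//.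
  by have := ltn_ord j; lia.
rewrite (bigD1 (Ordinal lti))//= eqxx big1 ?addr0// => j.
by rewrite -val_eqE/= eq_sym => /negbTE ->.
Qed.

(** Both sides are sums over the entries of x, and the pairs are disjoint. *)
Lemma dipole_le_l1 (x : 'I_d -> R) :
  \sum_j `|x (lo j) - x (hi j)| <= \sum_i `|x i|.
Proof.
apply: (@le_trans _ _ (\sum_j \sum_i `|dipole j i| * `|x i|)).
  apply: ler_sum => j _; rewrite -sum_dipole (le_trans (ler_norm_sum _ _ _))//.
  by apply: ler_sum => i _; rewrite normrM.
rewrite exchange_big; apply: ler_sum => i _.
by rewrite -mulr_suml ler_piMl// sum_norm_dipole.
Qed.

(** At most one dipole is nonzero at a given i, so the entries remain
    nonnegative, and every dipole has total mass zero. *)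
Lemma perturbed_uniform v : (0 < d)%N -> (forall j, `|v j| <= d%:R^-1) ->
  {p : simplex R d |
    forall i, tnth (val p) i = d%:R^-1 + \sum_j v j * dipole j i}.
Proof.
move=> d0 vd; have d0' : 0 < d%:R :> R by rewrite ltr0n.
pose f i := d%:R^-1 + \sum_j v j * dipole j i.
have fP : in_simplex [tuple f i | i < d].
  apply/andP; split.
    apply/forallP => i; rewrite tnth_mktuple /f.
    have H : `|\sum_j v j * dipole j i| <= d%:R^-1.
      rewrite (le_trans (ler_norm_sum _ _ _))//.
      rewrite (@le_trans _ _ (\sum_j d%:R^-1 * `|dipole j i|))//.
        by apply: ler_sum => j _; rewrite normrM ler_wpM2r.
      by rewrite -mulr_sumr ler_piMr ?invr_ge0 ?ler0n// sum_norm_dipole.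
    by move: H; rewrite ler_norml => /andP[H _]; lra.
  apply/eqP; under eq_bigr do rewrite tnth_mktuple.
  rewrite big_split/= sumr_const card_ord -[X in X + _]mulr_natl divff ?gt_eqF//.
  rewrite exchange_big big1 ?addr0// => j _.
  rewrite -mulr_sumr; have := sum_dipole j (fun=> 1).
  by under eq_bigr do rewrite mulr1; move=> ->; rewrite subrr mulr0.
exists (exist (fun p : d.-tuple R => in_simplex p) _ fP) => i.
by rewrite /= tnth_mktuple.
Qed.

Lemma perturbed_gap v (p : simplex R d) j :
  (forall i, tnth (val p) i = d%:R^-1 + \sum_j v j * dipole j i) ->
  tnth (val p) (lo j) - tnth (val p) (hi j) = 2 * v j.
Proof.
move=> pE; rewrite !pE opprD addrACA subrr add0r -sumrB (bigD1 j)//= big1 => [|j' j'j].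
  rewrite addr0 /dipole !eqxx -!val_eqE/=.
  have -> : (j.*2 == j.*2.+1) = false by lia.
  have -> : (j.*2.+1 == j.*2) = false by lia.
  rewrite subr0 sub0r mulr1 mulrN1; ring.
rewrite /dipole -!val_eqE/=; move: j'j; rewrite -val_eqE/= => j'j.
have -> : (j.*2 == j'.*2) = false by lia.
have -> : (j.*2 == j'.*2.+1) = false by lia.
have -> : (j.*2.+1 == j'.*2) = false by lia.
have -> : (j.*2.+1 == j'.*2.+1) = false by lia.
by rewrite subrr.
Qed.

End perturbation.

Section perturbed_mixture.
Context {R : realType} {disp} {Z : measurableType disp} {d : nat}.
Context (alpha : R) (Q : 'I_d -> probability Z R).
Hypotheses (ldp : LDP alpha Q) (alpha01 : 0 < alpha < 1).
Implicit Types (v : 'I_(d./2) -> R).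

(** Changing the perturbation from v to v' changes the law of a private
    observation by a linear combination of the differences of densities over
    the pairs, and these differences are of order alpha. *)
Lemma perturbed_density (p : simplex R d) : exists delta : 'I_(d./2) -> Z -> R,
  [/\ forall j, bounded_measurable (delta j),
      forall j z, `|delta j z| <= 6 * alpha &
      forall v v' p',
        (forall i, tnth (val p) i = d%:R^-1 + \sum_j v j * dipole j i) ->
        (forall i, tnth (val p') i = d%:R^-1 + \sum_j v' j * dipole j i) ->
        forall g, bounded_measurable g ->
        mean (mixture Q p') g =
        mean (mixture Q p) (fun z => g z * (1 + \sum_j (v' j - v j) * delta j z))].
Proof.
have [f [bf fa fE]] := LDP_densities p ldp alpha01.
exists (fun j z => f (lo j) z - f (hi j) z); split=> [j|j z|v v' p' pE p'E g bg].
- exact: bmB.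
- exact: fa.
pose h z := \sum_j (v' j - v j) * (f (lo j) z - f (hi j) z).
have bh : bounded_measurable h by apply: bm_sum => j; apply: bmZ; exact: bmB.
rewrite (_ : (fun z => g z * _) = (fun z => g z + g z * h z)); last first.
  by apply/funext => z; rewrite mulrDr mulr1.
rewrite meanD//; last exact: bmM.
apply/eqP; rewrite addrC -subr_eq; apply/eqP.
transitivity (\sum_j (v' j - v j) * (mean (Q (lo j)) g - mean (Q (hi j)) g)).
  rewrite !mean_mixture// -sumrB.
  under eq_bigr do rewrite -mulrBl p'E pE opprD addrACA subrr add0r -sumrB mulr_suml.
  rewrite exchange_big; apply: eq_bigr => j _.
  rewrite -(sum_dipole j (fun i => mean (Q i) g)) mulr_sumr.
  by apply: eq_bigr => i _; rewrite -mulrBl mulrA.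
rewrite (_ : (fun z => g z * h z) = (fun z =>
    \sum_j (v' j - v j) * (g z * f (lo j) z - g z * f (hi j) z))); last first.
  by apply/funext => z; rewrite mulr_sumr; apply: eq_bigr => j _; ring.
rewrite mean_sum => [|j]; last by apply: bmZ; apply: bmB; exact: bmM.
apply: eq_bigr => j _; rewrite meanZ ?meanB ?fE//; try exact: bmM.
by apply: bmB; exact: bmM.
Qed.

End perturbed_mixture.

Section random_signs.
Context {R : realType} {disp} {Z : measurableType disp}.

Let sqr_signD (b : bool) (x y : R) :
  ((-1) ^+ b * x + y) ^+ 2 = y ^+ 2 + (-1) ^+ b * (y * x + y * x) + x ^+ 2.
Proof. by case: b; rewrite ?expr1 ?expr0; ring. Qed.

(** Signs are chosen greedily: each one is chosen so that the cross term with the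
    sum built so far is nonpositive. The second moment of the signed sum is then
    at most the sum of the second moments, as for random signs on average. This
    gains a factor [size r] over the triangle inequality, and it is the source
    of the sqrt(d) in the contamination term. *)
Lemma balanced_signs (mu : probability Z R) (I : eqType) (r : seq I)
    (delta : I -> Z -> R) (c : R) : uniq r ->
  (forall i, bounded_measurable (delta i)) ->
  (forall i z, `|delta i z| <= c) ->
  exists s : I -> bool,
    mean mu (fun z => (\sum_(i <- r) (-1) ^+ s i * delta i z) ^+ 2) <=
    (size r)%:R * c ^+ 2.
Proof.
move=> + bd dc; elim: r => [_|i r ih /= /andP[ir ur]].
  exists xpred0; rewrite mul0r; under eq_fun do rewrite big_nil expr0n.
  by rewrite mean_cst.
have [s sE] := ih ur.
pose w z := \sum_(i <- r) (-1) ^+ s i * delta i z.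
have bw : bounded_measurable w by apply: bm_sum => k; exact: bmZ.
pose b := 0 <= mean mu (fun z => w z * delta i z).
exists (fun k => if k == i then b else s k).
rewrite (_ : (fun z => _) = (fun z => w z ^+ 2 +
    (-1) ^+ b * (w z * delta i z + w z * delta i z) + delta i z ^+ 2)); last first.
  apply/funext => z; rewrite big_cons eqxx (eq_big_seq (fun k => (-1) ^+ s k * delta k z)).
    by rewrite -/(w z) sqr_signD.
  by move=> k kr; case: eqP => // ki; move: ir; rewrite -ki kr.
have b1 : bounded_measurable (fun z => w z * delta i z) by exact: bmM.
have b2 : bounded_measurable (fun z => w z ^+ 2) by exact: bm_sqr.
have b3 : bounded_measurable (fun z => delta i z ^+ 2) by exact: bm_sqr.
have b4 := bmZ ((-1) ^+ b) (bmD b1 b1).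
rewrite (meanD mu (bmD b2 b4) b3) (meanD mu b2 b4) (meanZ mu _ (bmD b1 b1)).
rewrite (meanD mu b1 b1).
have H1 : (-1) ^+ b * (mean mu (fun z => w z * delta i z) +
    mean mu (fun z => w z * delta i z)) <= 0.
  rewrite /b; set m := mean _ _; case: (leP 0 m) => h0 /=.
    by rewrite expr1 mulN1r oppr_le0 addr_ge0.
  by rewrite expr0 mul1r ltW// ltr_wnDr// ltW.
have H2 : mean mu (fun z => delta i z ^+ 2) <= c ^+ 2.
  rewrite -(mean_cst mu (c ^+ 2)); apply: le_mean => //; first exact: bm_cst.
  by move=> z; rewrite -[leLHS]real_normK ?num_real// lerXn2r ?nnegrE ?(le_trans _ (dc i z)).
rewrite /= -nat1r mulrDl mul1r addrC; apply: lerD => //.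
by rewrite -[leRHS]addr0; exact: lerD sE H1.
Qed.

End random_signs.

(** * Contaminated samples and measurable covers *)

Section contamination.
Context {R : realType} {disp} {Z : measurableType disp}.

(** The set of contaminated indices is the complement of the range of [s]. *)
Lemma contamination_inj (n k : nat) (eps : R)
    (y : (nb_clean n eps).-tuple (k.-tuple Z)) (z : n.-tuple (k.-tuple Z))
    (s : 'I_(nb_clean n eps) -> 'I_n) :
  (n - nb_clean n eps)%:R = n%:R * eps -> injective s ->
  (forall i, tnth z (s i) = tnth y i) -> contamination y z.
Proof.
move=> card_eps s_inj zs; exists (~: [set s i | i in 'I_(nb_clean n eps)])%SET; split.
  by rewrite cardsCs finset.setCK card_imset// !card_ord.
rewrite finset.setCK.
have -> : tval y = [seq tnth z b | b <- map s (enum 'I_(nb_clean n eps))].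
  rewrite -map_comp -[LHS](map_tnth_enum y); apply: eq_map => i /=; exact/esym/zs.
apply: perm_map; apply: uniq_perm; first exact: enum_uniq.
  by rewrite map_inj_uniq// enum_uniq.
move=> b; rewrite mem_enum; apply/imsetP/mapP => [[i _ ->]|[i _ ->]]; exists i => //.
by rewrite mem_enum.
Qed.

End contamination.

Section covers.
Context {R : realType} {disp} {T : measurableType disp}.

(** The union of a nearly optimal countable cover. *)
Lemma mu_ext_cover (mu : probability T R) (X : set T) (r : R) :
  (mu_ext mu X < r%:E)%E ->
  exists A, [/\ measurable A, X `<=` A & mean mu \1_A <= r].
Proof.
move=> /ereal_inf_lt[_ [F [mF XF] <-] Fr].
have mUF : measurable (\bigcup_k F k) by exact: bigcup_measurable.
exists (\bigcup_k F k); split=> //.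
rewrite mean_indic// -lee_fin fineK ?fin_num_measure//.
rewrite (le_trans _ (ltW Fr))//; apply: measure_sigma_subadditive => //.
Qed.

End covers.

Section numerics.
Context {R : realType}.

Lemma nb_cleanE (n : nat) (eps : R) : eps <= 1 -> n%:R * (1 - eps) \is a Num.int ->
  (nb_clean n eps)%:R = n%:R * (1 - eps).
Proof.
move=> e1 int_n; rewrite /nb_clean truncnK// natrEint int_n mulr_ge0//; lra.
Qed.

(** (1 + x)^m <= exp(y) <= 1 / (1 - y) <= 1 + 2 y for y = m x at most 1/2. *)
Lemma expr1D_le (x : R) (m : nat) : 0 <= x -> m%:R * x <= 1 / 2 ->
  (1 + x) ^+ m <= 1 + 2 * (m%:R * x).
Proof.
move=> x0 mx; set y := m%:R * x in mx *.
have y0 : 0 <= y by rewrite mulr_ge0.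
have h1 : (1 + x) ^+ m <= expR y.
  rewrite /y expRM_natl lerXn2r ?nnegrE ?expR_ge0 ?expR_ge1Dx//; lra.
have h2 : 1 - y <= expR (- y) by exact: expR_ge1Dx.
have h3 : expR y * expR (- y) = 1 by rewrite -expRD subrr expR0.
have h4 : expR y * (1 - y) <= 1 by rewrite -[leRHS]h3 ler_wpM2l ?expR_ge0.
apply: (le_trans h1).
have : 1 <= (1 + 2 * y) * (1 - y) by nra.
move=> /(le_trans h4); rewrite ler_pM2r//; lra.
Qed.

End numerics.

(** * Lower bound from sampling *)

Section risk.
Context {R : realType}.

(** Bad events need not be measurable, so they are replaced by measurable
    supersets with nearly the same probability. *)
Lemma minimax_risk_lt (n k d : nat) (alpha eps psi r : R) :
  (minimax_risk n k alpha d eps psi < r%:E)%E ->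
  exists (disp : measure_display) (Z : measurableType disp)
    (Q : 'I_d -> probability Z R) (phat : n.-tuple (k.-tuple Z) -> simplex R d),
    [/\ LDP alpha Q,
        measurable_fun [set: n.-tuple (k.-tuple Z)]
            (fun z => val (phat z) : d.-tuple R) &
        forall p, exists A, [/\ measurable A, bad_event psi phat p `<=` A &
          mean (clean_law n k eps Q p) \1_A <= r]].
Proof.
move=> /ereal_inf_lt[_ [disp [Z [Q [phat [ldp mphat ->]]]]] risk_r].
exists disp, Z, Q, phat; split=> // p.
apply: mu_ext_cover; apply: le_lt_trans risk_r.
by apply: ereal_sup_ubound; exists p.
Qed.

Lemma not_bad_event {disp} {Z : measurableType disp} (n k d : nat)
    (eps psi : R) (phat : n.-tuple (k.-tuple Z) -> simplex R d) p y z :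
  ~ bad_event (eps := eps) psi phat p y -> contamination y z ->
  l1_dist (val (phat z)) (val p) <= psi.
Proof.
move=> /negP; rewrite -leNgt => bad yz; rewrite -lee_fin.
by apply: le_trans bad; apply: ereal_sup_ubound; exists z.
Qed.

End risk.

Section padding.
Context {R : realType} {disp} {X : measurableType disp}.
Context (n n' : nat) (x0 : X).

(** Contaminates a sample by appending copies of a fixed batch. *)
Definition pad (y : n'.-tuple X) : n.-tuple X := [tuple nth x0 y i | i < n].

Lemma measurable_pad : measurable_fun setT pad.
Proof.
apply/measurable_fun_tnthP => i.
have [lt_in'|le_n'i] := ltnP i n'.
  rewrite (_ : _ \o _ = @tnth _ _ ^~ (Ordinal lt_in')); first exact: measurable_tnth.
  by apply/funext => y; rewrite /= tnth_mktuple (tnth_nth x0).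
rewrite (_ : _ \o _ = cst x0); first exact: measurable_cst.
by apply/funext => y; rewrite /= tnth_mktuple nth_default// size_tuple.
Qed.

Lemma tnth_pad (le_n'n : (n' <= n)%N) y i :
  tnth (pad y) (widen_ord le_n'n i) = tnth y i.
Proof. by rewrite tnth_mktuple (tnth_nth x0). Qed.

End padding.

Section sampling.
Context {R : realType} (d n k : nat) (alpha eps psi : R).
Hypotheses (d3 : (3 <= d)%N) (n1 : (1 <= n)%N) (k1 : (1 <= k)%N).
Hypotheses (alpha01 : 0 < alpha < 1) (eps01 : 0 < eps < 1 / 4).
Hypothesis int_n : n%:R * (1 - eps) \is a Num.int.
Hypotheses (psi0 : 0 < psi).

Local Notation n' := (nb_clean n eps).
Local Notation D := (d./2).

Let alpha0 : 0 < alpha. Proof. by case/andP: alpha01. Qed.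
Let eps0 : 0 < eps. Proof. by case/andP: eps01. Qed.
Let eps1 : eps <= 1. Proof. by case/andP: eps01; lra. Qed.
Let d_gt0 : (0 < d)%N. Proof. exact: leq_trans d3. Qed.
Let d0 : 0 < d%:R :> R. Proof. by rewrite ltr0n. Qed.
Let n0 : 0 < n%:R :> R. Proof. by rewrite ltr0n. Qed.
Let k0 : 0 < k%:R :> R. Proof. by rewrite ltr0n. Qed.

Lemma nb_clean_le : (n' <= n)%N.
Proof. by rewrite -(ler_nat R) nb_cleanE// ler_piMr// gerBl ltW. Qed.

Lemma nb_contaminated : (n - n')%:R = n%:R * eps.
Proof. by rewrite natrB ?nb_clean_le// nb_cleanE//; ring. Qed.

Lemma output_inhabited {disp} (Z : measurableType disp)
    (Q : 'I_d -> probability Z R) : inhabited Z.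
Proof.
pose i0 := Ordinal d_gt0.
apply: contrapT => noz; have := probability_setT (Q i0).
rewrite (_ : setT = set0) ?measure0; first by move/eqP; rewrite eq_sym onee_eq0.
by apply/seteqP; split=> // z _; case: noz.
Qed.

Lemma le_triple_half : d%:R <= 3 * D%:R :> R.
Proof.
clear -d3; rewrite -[3]/(3%:R) -natrM ler_nat.
by have := odd_double_half d; case: odd; move: d3; lia.
Qed.

Definition flip (j : 'I_D) (u : {ffun 'I_D -> bool}) : {ffun 'I_D -> bool} :=
  [ffun i => if i == j then ~~ u i else u i].

Lemma flipK j : involutive (flip j).
Proof. by move=> u; apply/ffunP => i; rewrite !ffunE; case: eqP; rewrite ?negbK. Qed.

(** Assouad's argument on the hypercube of the distributions with entries
    (1 + g)/d and (1 - g)/d, in one order or the other, on each pair. Flipping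
    one sign changes the law of one private observation by a relative density
    of at most 12 g alpha / d, hence the laws of all k n' observations remain
    at distance 1/2 at most if g is of order d / (alpha sqrt(k n)). No test
    can then determine a sign with total error less than 1/2, although an
    estimator with l1 error psi would determine all but psi d / (2 g) of them,
    with probability at least 6/7.
    The constant 34 is such that (12 / 34)^2 <= 1/8. *)
Lemma sampling_lower_bound :
  (minimax_risk n k alpha d eps psi <= (1 / 8)%:E)%E ->
  Num.min (d%:R / (alpha * Num.sqrt (k%:R * n%:R))) 1 / 476 <= psi.
Proof.
move=> risk.
have /minimax_risk_lt[disp [Z [Q [phat [ldp mphat cover]]]]] :
    (minimax_risk n k alpha d eps psi < (1 / 7)%:E)%E.
  by apply: le_lt_trans risk _; rewrite lte_fin; lra.
have [z0] := output_inhabited Q.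
set s := Num.sqrt (k%:R * n%:R).
have s0 : 0 < s by rewrite sqrtr_gt0 mulr_gt0.
have s2 : s ^+ 2 = k%:R * n%:R by rewrite sqr_sqrtr// mulr_ge0// ltW.
set r := d%:R / (alpha * s).
have r0 : 0 < r by rewrite divr_gt0 ?mulr_gt0.
pose g := Num.min r 1 / 34.
have g0 : 0 < g by rewrite divr_gt0// lt_min r0 ltr01.
have g20 : 0 < 2 * g by exact: mulr_gt0.
have g1 : g <= 1 / 34 by rewrite ler_pM2r ?invr_gt0// ge_min lexx orbT.
have gr : g <= r / 34 by rewrite ler_pM2r ?invr_gt0// ge_min lexx.
suff : g / 14 <= psi by rewrite /g; lra.
pose v (u : {ffun 'I_D -> bool}) (j : 'I_D) : R := (-1) ^+ (~~ u j) * (g / d%:R).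
have vd u j : `|v u j| <= d%:R^-1.
  rewrite normrM normrX normrN1 expr1n mul1r ger0_norm; last by rewrite divr_ge0 ?(ltW g0) ?(ltW d0).
  by rewrite ler_piMl ?invr_ge0 ?(ltW d0)//; lra.
pose p u := sval (perturbed_uniform d_gt0 (vd u)).
have pE u i : tnth (val (p u)) i = d%:R^-1 + \sum_j v u j * dipole j i.
  by rewrite /p; case: perturbed_uniform.
pose P u := clean_law n k eps Q (p u).
have TV u j (f : n'.-tuple (k.-tuple Z) -> R) : bounded_measurable f ->
    (forall y, 0 <= f y <= 1) -> `|mean (P (flip j u)) f - mean (P u) f| <= 1 / 2.
  move=> bf f01; apply: L2_dominated_mean_close => //.
  have [delta [bdelta delta_le deltaE]] := perturbed_density ldp alpha01 (p u).
  have gd0 : 0 <= g / d%:R by rewrite divr_ge0 ?(ltW g0) ?(ltW d0).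
  pose c := 2 * (g / d%:R) * (6 * alpha).
  have c0 : 0 <= c by apply: mulr_ge0; [exact: mulr_ge0|rewrite mulr_ge0// ltW].
  pose w := c ^+ 2.
  have dom1 : L2_dominated (1 + w) (mixture Q (p u)) (mixture Q (p (flip j u))).
    pose h z := (v (flip j u) j - v u j) * delta j z.
    have hE z : \sum_i (v (flip j u) i - v u i) * delta i z = h z.
      rewrite (bigD1 j)//= big1 ?addr0// => i ij.
      by rewrite /v ffunE (negbTE ij) subrr mul0r.
    apply: (@L2_dominated_density _ _ _ _ _ h); first exact: bmZ.
      move=> f1 bf1; rewrite (deltaE _ _ _ (pE u) (pE (flip j u)))//.
      by under eq_fun do rewrite hE.
    rewrite -(mean_cst (mixture Q (p u)) w); apply: le_mean; first 2 last.
    - move=> z; rewrite -[leLHS]real_normK ?num_real//.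
      rewrite lerXn2r ?nnegrE// normrM /v ffunE eqxx.
      rewrite (_ : `|_ - _| = 2 * (g / d%:R)); first by rewrite ler_wpM2l// mulr_ge0.
      case: (u j) => /=; rewrite -mulrBl normrM (ger0_norm gd0); congr (_ * _).
        by rewrite expr1 expr0 (_ : -1 - 1 = - 2) ?normrN ?ger0_norm//; ring.
      by rewrite expr1 expr0 (_ : 1 - -1 = 2) ?ger0_norm//; ring.
    - by apply: bm_sqr; exact: bmZ.
    - exact: bm_cst.
  have w0 : 0 <= w by exact: sqr_ge0.
  have dom : L2_dominated ((1 + w) ^+ (k * n')) (P u) (P (flip j u)).
    rewrite exprM; apply: L2_dominated_iid; first by rewrite exprn_ge0//; lra.
    by apply: L2_dominated_iid => //; lra.
  apply: L2_dominatedW dom.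
  have knw : (k * n')%:R * w <= 1 / 8.
    rewrite /w natrM (@le_trans _ _ (k%:R * n%:R * (2 * (r / 34 / d%:R) * (6 * alpha)) ^+ 2))//.
      apply: ler_pM; [by rewrite mulr_ge0|exact: w0| |].
        by rewrite ler_wpM2l ?ler_nat ?nb_clean_le// ltW.
      have gr0 : g / d%:R <= r / 34 / d%:R by rewrite ler_pM2r ?invr_gt0.
      have cr : c <= 2 * (r / 34 / d%:R) * (6 * alpha).
        by rewrite /c ler_pM2r ?mulr_gt0// ler_pM2l.
      by rewrite lerXn2r// nnegrE// (le_trans c0 cr).
    rewrite -s2 /r (_ : s ^+ 2 * _ = 144 / 1156); first by lra.
    by field; rewrite !gt_eqF.
  apply: le_trans (expr1D_le w0 _) _; first by lra.
  by lra.
(* The contaminated batches carry no information here: they are constant. The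
   j-th sign is estimated from the estimator by comparing the two entries of
   the j-th pair. *)
pose est (y : n'.-tuple (k.-tuple Z)) := val (phat (pad n [tuple z0 | i < k] y)).
pose S j := [set y | tnth (est y) (hi j) < tnth (est y) (lo j)].
have mest i : measurable_fun setT (fun y => tnth (est y) i).
  apply: (measurableT_comp (measurable_tnth i)).
  by apply: (measurableT_comp mphat); exact: measurable_pad.
have mS j : measurable (S j).
  have := measurable_fun_ltr (mest (hi j)) (mest (lo j)).
  move=> /(_ measurableT [set true] (I : measurable [set true])); rewrite setTI.
  by congr measurable; apply/seteqP; split=> y.
pose err u j (y : n'.-tuple (k.-tuple Z)) : R :=
  if u j then 1 - \1_(S j) y else \1_(S j) y.
have berr u j : bounded_measurable (err u j).
  rewrite /err; case: (u j); last exact: bm_indic.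
  by apply: bmB; [exact: bm_cst|exact: bm_indic].
have pair u j : 1 / 2 <= mean (P u) (err u j) + mean (P (flip j u)) (err (flip j u) j).
  have b1 : bounded_measurable (\1_(S j) : _ -> R) by exact: bm_indic.
  have := TV u j _ b1; rewrite ler_norml => TVu.
  have /TVu/andP[] : forall y, 0 <= (\1_(S j) y : R) <= 1.
    by move=> y; rewrite indicE; case: (_ \in _); rewrite lexx ler01.
  rewrite /err ffunE eqxx; case: (u j) => /=; rewrite meanB ?mean_cst//; try exact: bm_cst.
    by clear; lra.
  by clear; lra.
have upper u : \sum_j mean (P u) (err u j) <= psi * d%:R / (2 * g) + D%:R / 7.
  have [A [mA badA PA]] := cover (p u).
  rewrite -mean_sum//.
  have bA : bounded_measurable (\1_A : _ -> R) by exact: bm_indic.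
  have le_sum y : \sum_j err u j y <= psi * d%:R / (2 * g) + D%:R * \1_A y.
    have err1 j : err u j y <= 1.
      rewrite /err !indicE; case: (u j); case: (_ \in _);
        by rewrite /= ?subr0 ?subrr ?lexx ?ler01.
    have [yA|yA] := pselect (A y).
      rewrite indicE mem_set// mulr1 (@le_trans _ _ D%:R)//; last first.
        by rewrite lerDr; apply: divr_ge0; apply: mulr_ge0; rewrite // ltW.
      by rewrite (le_trans (ler_sum _ (fun j _ => err1 j)))// sumr_const card_ord.
    rewrite indicE memNset// mulr0 addr0 ler_pdivlMr//.
    have yz : contamination y (pad n [tuple z0 | i < k] y).
      apply: (contamination_inj (s := widen_ord nb_clean_le)).
      - exact: nb_contaminated.
      - by move=> i i' /(congr1 val)/= /val_inj.
      - by move=> i; exact: tnth_pad.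
    have := not_bad_event (fun bad => yA (badA y bad)) yz.
    rewrite -(ler_pM2r d0); apply: le_trans.
    pose x i := tnth (est y) i - tnth (val (p u)) i.
    have errx j : err u j y * (2 * (g / d%:R)) <= `|x (lo j) - x (hi j)|.
      have gap := perturbed_gap j (pE u).
      have xE : x (lo j) - x (hi j) =
          tnth (est y) (lo j) - tnth (est y) (hi j) - 2 * v u j.
        by rewrite -gap /x; ring.
      rewrite {}xE /err /v indicE.
      have [yS|yS] := boolP (y \in S j).
        move: yS; rewrite inE /S/= -subr_gt0 => yS.
        case: (u j); rewrite ?subrr ?mul0r//= expr1 mulN1r mulrN opprK mul1r.
        by rewrite (le_trans _ (ler_norm _))// lerDr ltW.
      move: yS; rewrite notin_setE /S/= => /negP; rewrite -leNgt -subr_le0 => yS.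
      case: (u j); rewrite ?mul0r//= expr0 mul1r subr0 mul1r -normrN.
      by rewrite (le_trans _ (ler_norm _))// opprB lerBrDr gerDl.
    rewrite -ler_pdivrMr// -mulrA mulr_suml.
    apply: le_trans (dipole_le_l1 x); apply: ler_sum => j _.
    by rewrite -[2 * g / d%:R]mulrA.
  rewrite (le_trans (le_mean _ _ _ le_sum))//; first exact: bm_sum.
    by apply: bmD; [exact: bm_cst|exact: bmZ].
  rewrite meanD ?mean_cst ?meanZ//; [|exact: bm_cst|exact: bmZ].
  by rewrite lerD2l ler_wpM2l//; lra.
pose U := {ffun 'I_D -> bool}.
have lower : #|U|%:R * (D%:R / 4) <= \sum_(u : U) \sum_j mean (P u) (err u j).
  rewrite exchange_big/=.
  have Sj j : #|U|%:R / 4 <= \sum_(u : U) mean (P u) (err u j).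
    have : \sum_(u : U) (1 / 2 : R) <= \sum_(u : U)
        (mean (P u) (err u j) + mean (P (flip j u)) (err (flip j u) j)).
      by apply: ler_sum => u _; exact: pair.
    rewrite big_split/= -(reindex_inj (inv_inj (flipK j)) (P := xpredT)
      (F := fun u => mean (P u) (err u j)))/=.
    by rewrite sumr_const -mulr_natl; lra.
  apply: le_trans (ler_sum _ (fun j _ => Sj j)).
  by rewrite sumr_const card_ord -mulr_natl; lra.
have : #|U|%:R * (D%:R / 4) <= #|U|%:R * (psi * d%:R / (2 * g) + D%:R / 7).
  apply: le_trans lower _; rewrite mulr_natl -sumr_const.
  by apply: ler_sum => u _; exact: upper.
have U0 : 0 < #|U|%:R :> R.
  by rewrite ltr0n; apply/card_gt0P; exists [ffun=> true].
rewrite ler_pM2l// => H.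
have dD : d%:R <= 3 * D%:R :> R.
  exact: le_triple_half.
have : D%:R * (3 / 28) <= psi * d%:R / (2 * g) by lra.
rewrite ler_pdivlMr// => H2.
have H3 : d%:R * (g / 14) <= d%:R * psi by nra.
by rewrite ler_pM2l in H3.
Qed.

End sampling.

(** * Lower bound from contamination *)

Section common_contamination.
Context {R : realType} {disp} {Z : measurableType disp} {n k : nat} {eps : R}.
Local Notation n' := (nb_clean n eps).
Hypotheses (le_n'n : (n' <= n)%N) (card_eps : (n - n')%:R = n%:R * eps).

(** Keep y and append those entries of y' that differ from the entries of y at
    the same place; both samples can be extracted from the result. *)
Lemma common_contamination (y y' : n'.-tuple (k.-tuple Z)) (x0 : k.-tuple Z) :
  (hamming y y' <= n - n')%N ->
  exists z, contamination y z /\ contamination y' z.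
Proof.
pose P := [pred i : 'I_n' | tnth y i != tnth y' i].
have -> : hamming y y' = #|P|.
  by rewrite /hamming -sum1_card [RHS]big_mkcond; apply: eq_bigr => i _; rewrite inE; case: eqP.
rewrite cardE => sizeP.
pose z := [tuple nth x0 (y ++ [seq tnth y' i | i <- enum P]) b | b < n].
pose v (i : 'I_n') : nat := if P i then (n' + index i (enum P))%N else i.
have vn i : (v i < n)%N.
  rewrite /v; case: ifP => Pi; last exact: leq_trans (ltn_ord i) le_n'n.
  rewrite -ltn_subRL (leq_trans _ sizeP)// index_mem mem_enum//.
exists z; split.
  apply: (contamination_inj (s := widen_ord le_n'n)) => //.
    by move=> i i' /(congr1 val)/= /val_inj.
  by move=> i; rewrite tnth_mktuple nth_cat size_tuple/= ltn_ord (tnth_nth x0).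
apply: (contamination_inj (s := fun i => Ordinal (vn i))) => //.
  move=> i i' /(congr1 val)/=; rewrite /v.
  case: ifP => Pi; case: ifP => Pi'.
  - move=> /addnI ii'; have iP : i \in enum P by rewrite mem_enum.
    have iP' : i' \in enum P by rewrite mem_enum.
    by rewrite -(nth_index i iP) ii' nth_index.
  - by move=> vE; have := ltn_ord i'; rewrite -vE ltnNge leq_addr.
  - by move=> vE; have := ltn_ord i; rewrite vE ltnNge leq_addr.
  - by move/val_inj.
move=> i; rewrite tnth_mktuple nth_cat size_tuple/= /v; have [Pi|Pi] := boolP (P i).
  rewrite ltnNge leq_addr/= addKn.
  have iP : i \in enum P by rewrite mem_enum.
  by rewrite (nth_map i) ?index_mem// nth_index.
rewrite ltn_ord -(tnth_nth x0); by move: Pi; rewrite /= negbK => /eqP.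
Qed.

End common_contamination.

Section contamination_bound.
Context {R : realType} (d n k : nat) (alpha eps psi : R).
Hypotheses (d3 : (3 <= d)%N) (n1 : (1 <= n)%N) (k1 : (1 <= k)%N).
Hypotheses (alpha01 : 0 < alpha < 1) (eps01 : 0 < eps < 1 / 4).
Hypothesis int_n : n%:R * (1 - eps) \is a Num.int.

Local Notation n' := (nb_clean n eps).
Local Notation D := (d./2).

Let alpha0 : 0 < alpha. Proof. by case/andP: alpha01. Qed.
Let eps0 : 0 < eps. Proof. by case/andP: eps01. Qed.
Let d_gt0 : (0 < d)%N. Proof. exact: leq_trans d3. Qed.
Let d0 : 0 < d%:R :> R. Proof. by rewrite ltr0n. Qed.
Let n0 : 0 < n%:R :> R. Proof. by rewrite ltr0n. Qed.
Let k0 : 0 < k%:R :> R. Proof. by rewrite ltr0n. Qed.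

(** Two-point argument between the uniform distribution p0 and a perturbation
    p1 of it by signs that make one private observation as little informative
    as possible: its chi-square divergence is of order (g alpha)^2 / d instead
    of (g alpha)^2. For g of order (eps / alpha) sqrt(d / k), the laws of one
    batch are eps/4-close, so that samples of n' batches can be thought of as
    differing in n eps / 4 places on average. As soon as they differ in at
    most n eps places, they share a contamination, and no estimator can be
    right for both p0 and p1.
    The constant 34 is such that 2 (6 / 34)^2 <= 1/16. *)
Lemma contamination_lower_bound :
  (minimax_risk n k alpha d eps psi <= (1 / 8)%:E)%E ->
  Num.min (eps / alpha * Num.sqrt (d%:R / k%:R)) 1 / 102 <= psi.
Proof.
move=> risk.
have /minimax_risk_lt[disp [Z [Q [phat [ldp mphat cover]]]]] :
    (minimax_risk n k alpha d eps psi < (1 / 7)%:E)%E.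
  by apply: le_lt_trans risk _; rewrite lte_fin; lra.
have [z0] := output_inhabited d3 Q.
set s := Num.sqrt (d%:R / k%:R).
have s0 : 0 < s by rewrite sqrtr_gt0 divr_gt0.
have s2 : s ^+ 2 = d%:R / k%:R by rewrite sqr_sqrtr// divr_ge0// ltW.
set r := eps / alpha * s.
have r0 : 0 < r by rewrite mulr_gt0// divr_gt0.
pose g := Num.min r 1 / 34.
have g0 : 0 < g by rewrite divr_gt0// lt_min r0 ltr01.
have g1 : g <= 1 / 34 by rewrite ler_pM2r ?invr_gt0// ge_min lexx orbT.
have gr : g <= r / 34 by rewrite ler_pM2r ?invr_gt0// ge_min lexx.
suff : g / 3 <= psi by rewrite /g; lra.
have gd0 : 0 <= g / d%:R by rewrite divr_ge0 ?(ltW g0) ?(ltW d0).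
have gd1 : g / d%:R <= d%:R^-1.
  rewrite ler_piMl ?invr_ge0 ?(ltW d0)//; lra.
have v0d (j : 'I_D) : `|0 : R| <= d%:R^-1 by rewrite normr0 invr_ge0 ltW.
have [p0 p0E] := perturbed_uniform (v := fun=> 0) d_gt0 v0d.
clear v0d.
have [delta [bdelta delta_le deltaE]] := perturbed_density ldp alpha01 p0.
have [sg sgE] := balanced_signs (mixture Q p0) (enum_uniq 'I_D) bdelta delta_le.
pose v (j : 'I_D) : R := (-1) ^+ sg j * (g / d%:R).
have vE j : `|v j| = g / d%:R.
  by rewrite normrM normrX normrN1 expr1n mul1r ger0_norm.
have vd j : `|v j| <= d%:R^-1 by rewrite vE.
have [p1 p1E] := perturbed_uniform d_gt0 vd.
rewrite leNgt; apply/negP => psi_lt.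
have sep : 2 * psi < l1_dist (val p0) (val p1).
  have le1 := dipole_le_l1 (fun i => tnth (val p0) i - tnth (val p1) i).
  apply: lt_le_trans le1.
  rewrite (eq_bigr (fun=> 2 * (g / d%:R))) => [|j _]; last first.
    have -> : tnth (val p0) (lo j) - tnth (val p1) (lo j) -
        (tnth (val p0) (hi j) - tnth (val p1) (hi j)) =
        tnth (val p0) (lo j) - tnth (val p0) (hi j) -
        (tnth (val p1) (lo j) - tnth (val p1) (hi j)) by ring.
    rewrite (perturbed_gap j p0E) (perturbed_gap j p1E) mulr0 sub0r normrN.
    by rewrite normrM vE ger0_norm.
  rewrite sumr_const card_ord -[ltRHS]mulr_natl.
  have dD := le_triple_half (R := R) d3.
  have : g * d%:R <= g * (3 * D%:R) by rewrite ler_wpM2l ?(ltW g0).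
  rewrite (_ : _ * (2 * _) = 2 * (g * D%:R / d%:R)); last by ring.
  rewrite ltr_pM2l// ltr_pdivlMr// => H.
  apply: (@lt_le_trans _ _ (g / 3 * d%:R)); first by rewrite ltr_pM2r.
  by rewrite mulrAC ler_pdivrMr// -(mulrA g D%:R) (mulrC D%:R).
(* w bounds the chi-square divergence of one private observation; the number
   d / 2 of pairs is bounded by d. *)
pose w := (g / d%:R) ^+ 2 * (d%:R * (6 * alpha) ^+ 2).
have wE : mean (mixture Q p0) (fun z => (\sum_j v j * delta j z) ^+ 2) <= w.
  rewrite (_ : (fun z => _) = (fun z => (g / d%:R) ^+ 2 *
      (\sum_(j <- enum 'I_D) (-1) ^+ sg j * delta j z) ^+ 2)); last first.
    apply/funext => z; rewrite -exprMn mulr_sumr big_enum/=.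
    by congr (_ ^+ 2); apply: eq_bigr => j _; rewrite /v; ring.
  rewrite meanZ; last by apply: bm_sqr; apply: bm_sum => j; exact: bmZ.
  rewrite /w ler_wpM2l ?sqr_ge0//.
  rewrite (le_trans sgE)// ler_wpM2r ?sqr_ge0// ler_nat size_enum_ord.
  by rewrite -{2}(odd_double_half d) -addnn addnA leq_addl.
have w0 : 0 <= w by apply: mulr_ge0; [|apply: mulr_ge0]; rewrite ?sqr_ge0// ltW.
have dom1 : L2_dominated (1 + w) (mixture Q p0) (mixture Q p1).
  apply: (@L2_dominated_density _ _ _ _ _ (fun z => \sum_j v j * delta j z)) => //.
    by apply: bm_sum => j; exact: bmZ.
  move=> f bf; rewrite (deltaE _ _ _ p0E p1E)//; congr mean; apply/funext => z.
  by congr (_ * (1 + _)); apply: eq_bigr => j _; rewrite subr0.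
have eps20 : 0 <= eps ^+ 2 by exact: sqr_ge0.
have kw : k%:R * w <= eps ^+ 2 / 32.
  have -> : k%:R * w = (k%:R * 36 * alpha ^+ 2 / d%:R) * g ^+ 2.
    by rewrite /w; field; rewrite gt_eqF.
  apply: (@le_trans _ _ ((k%:R * 36 * alpha ^+ 2 / d%:R) * (r / 34) ^+ 2)).
    apply: ler_wpM2l; last by rewrite lerXn2r// nnegrE ?(ltW g0)// divr_ge0 ?(ltW r0).
    by rewrite divr_ge0 ?(ltW d0)// mulr_ge0 ?sqr_ge0// mulr_ge0// ltW.
  rewrite /r (_ : _ * _ = 36 / 1156 * (k%:R / d%:R) * eps ^+ 2 * s ^+ 2); last first.
    by field; rewrite !gt_eqF.
  rewrite s2 (_ : _ * _ = 36 / 1156 * eps ^+ 2); first lra.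
  by field; rewrite !gt_eqF.
have /andP[_ eps_lt] := eps01.
have eps_le1 : eps ^+ 2 <= 1 by rewrite expr_le1 ?(ltW eps0)//; lra.
have eps40 : 0 < eps / 4 by rewrite divr_gt0.
have close : forall f, bounded_measurable f -> (forall x, 0 <= f x <= 1) ->
    `|mean (iid_law (mixture Q p1) k) f - mean (iid_law (mixture Q p0) k) f| <= eps / 4.
  move=> f bf f01; apply: L2_dominated_mean_close => //.
  apply: L2_dominatedW (L2_dominated_iid (m := k) _ dom1); last by rewrite addr_ge0.
  apply: le_trans (expr1D_le w0 _) _; first by lra.
  by rewrite lerD2l (_ : (eps / 4) ^+ 2 = eps ^+ 2 / 16); [lra|field].
(* If y and y' differ in at most n - n' batches, a common contamination of both
   cannot lead to an estimate close to p0 and p1 at the same time. *)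
have le_n'n := nb_clean_le eps01 int_n.
have card_eps := nb_contaminated eps01 int_n.
have m0 : 0 < (n - n')%:R :> R by rewrite card_eps mulr_gt0.
have [A0 [mA0 badA0 PA0]] := cover p0.
have [A1 [mA1 badA1 PA1]] := cover p1.
have b0 : bounded_measurable (\1_A0 : _ -> R) by exact: bm_indic.
have b1 : bounded_measurable (\1_A1 : _ -> R) by exact: bm_indic.
have binv : 0 < (n - n')%:R^-1 :> R by rewrite invr_gt0.
have dual := transport_duality_iid binv close (a := 1) b0 b1.
have indic_ge0 (A : set (n'.-tuple (k.-tuple Z))) y : 0 <= (\1_A y : R).
  by rewrite indicE.
have {}dual : 1 - (n - n')%:R^-1 * (n'%:R * (eps / 4)) <=
    mean (iid_law (iid_law (mixture Q p0) k) n') \1_A0 +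
    mean (iid_law (iid_law (mixture Q p1) k) n') \1_A1.
  apply: dual => y y'.
  have [hle|hlt] := leqP (hamming y y') (n - n'); last first.
    rewrite (@le_trans _ _ 0) ?addr_ge0// subr_le0 mulrC ler_pdivlMr// mul1r.
    by rewrite ler_nat ltnW.
  have [z [zy zy']] := common_contamination le_n'n card_eps [tuple z0 | _ < k] hle.
  have one_le : 1 <= \1_A0 y + \1_A1 y' :> R.
    have [y0|y0] := pselect (A0 y); first by rewrite [X in X + _]indicE mem_set// lerDl.
    have [y1|y1] := pselect (A1 y'); first by rewrite [X in _ + X]indicE mem_set// lerDr.
    have h0 := not_bad_event (fun bad => y0 (badA0 y bad)) zy.
    have h1 := not_bad_event (fun bad => y1 (badA1 y' bad)) zy'.
    suff : l1_dist (val p0) (val p1) <= 2 * psi by rewrite leNgt sep.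
    rewrite mulr_natl mulr2n (le_trans _ (lerD h0 h1))// /l1_dist -big_split/=.
    apply: ler_sum => i _; rewrite [X in _ <= X + _]distrC.
    exact: ler_distD.
  by rewrite (le_trans _ one_le)// gerBl mulr_ge0// ltW.
have P0 : mean (iid_law (iid_law (mixture Q p0) k) n') \1_A0 <= 1 / 7 by exact: PA0.
have P1 : mean (iid_law (iid_law (mixture Q p1) k) n') \1_A1 <= 1 / 7 by exact: PA1.
have : (n - n')%:R^-1 * (n'%:R * (eps / 4)) <= 1 / 4.
  rewrite mulrC ler_pdivrMr// card_eps.
  have : n'%:R * eps <= n%:R * eps by rewrite ler_wpM2r ?ler_nat ?(ltW eps0).
  lra.
lra.
Qed.

End contamination_bound.

(** * Sub-Gaussian bounds for biased signs *)

Section subgaussian.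
Context {R : realType}.
Implicit Types (t b a : R).

Definition cosh t : R := (expR t + expR (- t)) / 2.
Definition sinh t : R := (expR t - expR (- t)) / 2.

Lemma cosh_gt0 t : 0 < cosh t.
Proof. by rewrite divr_gt0// addr_gt0 ?expR_gt0. Qed.

(** From exp(u - u^2) <= 1 / (1 - u + u^2) for u = t and u = - t; the two bounds
    sum to 2 (1 + t^2) / (1 + t^2 + t^4) <= 2. *)
Lemma cosh_le t : cosh t <= expR (t ^+ 2).
Proof.
have pos (u : R) : 0 < 1 + (u ^+ 2 - u) by have := sqr_ge0 (2 * u - 1); nra.
have bound (u : R) : expR u <= expR (u ^+ 2) / (1 + (u ^+ 2 - u)).
  rewrite (ler_pdivlMr _ _ (pos u)).
  have -> : expR u = expR (u ^+ 2) * expR (- (u ^+ 2 - u)).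
    by rewrite -expRD; congr expR; ring.
  rewrite -mulrA ger_pMr ?expR_gt0//.
  have inv : expR (- (u ^+ 2 - u)) * expR (u ^+ 2 - u) = 1.
    by rewrite -expRD addNr expR0.
  by rewrite -[leRHS]inv ler_wpM2l ?expR_ge0 ?expR_ge1Dx.
have bt := bound t; have bNt := bound (- t).
rewrite sqrrN opprK in bNt; have pNt := pos (- t); rewrite sqrrN opprK in pNt.
have pt := pos t.
rewrite /cosh ler_pdivrMr// (le_trans (lerD bt bNt))// -mulrDr ler_wpM2l ?expR_ge0//.
rewrite -[X in X + _]div1r -[X in _ + X]div1r addf_div ?gt_eqF// ler_pdivrMr ?mulr_gt0//.
have := sqr_ge0 (t ^+ 2); lra.
Qed.

(** A sign of mean b has moment generating function cosh t + b sinh t. After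
    centering, exp(- b t) is bounded by convexity by the moment generating
    function cosh t - b sinh t of an opposite independent sign (symmetrization),
    and the product is at most cosh(t)^2. *)
Lemma cosh_sinh_le t b : -1 <= b <= 1 ->
  0 <= (cosh t + b * sinh t) * expR (- (b * t)) <= expR (t ^+ 2) ^+ 2.
Proof.
move=> /andP[b1 b2].
have et := expR_gt0 t; have eNt := expR_gt0 (- t).
have pos : 0 <= cosh t + b * sinh t.
  rewrite (_ : _ + _ = ((1 + b) * expR t + (1 - b) * expR (- t)) / 2).
    by apply: divr_ge0 => //; apply: addr_ge0; apply: mulr_ge0; lra.
  by rewrite /cosh /sinh; field.
rewrite mulr_ge0 ?expR_ge0//=.
have tangent (u : R) : expR (- (b * t)) * (1 + (u + b * t)) <= expR u.
  rewrite (_ : expR u = expR (- (b * t)) * expR (u + b * t)).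
    by rewrite ler_wpM2l ?expR_ge0 ?expR_ge1Dx.
  by rewrite -expRD; congr expR; ring.
have conv : expR (- (b * t)) <= cosh t - b * sinh t.
  have h1 : (1 - b) * (expR (- (b * t)) * (1 + (t + b * t))) <= (1 - b) * expR t.
    by rewrite ler_wpM2l//; lra.
  have h2 : (1 + b) * (expR (- (b * t)) * (1 + (- t + b * t))) <= (1 + b) * expR (- t).
    by rewrite ler_wpM2l//; lra.
  have -> : cosh t - b * sinh t = ((1 - b) * expR t + (1 + b) * expR (- t)) / 2.
    by rewrite /cosh /sinh; field.
  rewrite ler_pdivlMr// (le_trans _ (lerD h1 h2))//.
  by rewrite le_eqVlt; apply/orP; left; apply/eqP; ring.
apply: (@le_trans _ _ ((cosh t + b * sinh t) * (cosh t - b * sinh t))).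
  by rewrite ler_wpM2l.
rewrite (_ : _ * _ = cosh t ^+ 2 - (b * sinh t) ^+ 2); last by ring.
have := sqr_ge0 (b * sinh t).
have : cosh t ^+ 2 <= expR (t ^+ 2) ^+ 2.
  by rewrite lerXn2r ?nnegrE ?expR_ge0 ?cosh_le// ltW// cosh_gt0.
lra.
Qed.

End subgaussian.

(** * A private mechanism with sign vectors as outputs *)

Section discrete.

Lemma measurable_tuple_set1 disp (T : measurableType disp) (m : nat) :
  (forall x : T, measurable [set x]) -> forall y : m.-tuple T, measurable [set y].
Proof.
move=> T1 y.
rewrite (_ : [set y] = \bigcap_(i in setT) (@tnth m T ^~ i @^-1` [set tnth y i])).
  apply: fin_bigcap_measurable => [|i _]; first exact: finite_finset.
  by rewrite -[X in measurable X]setTI; exact: measurable_tnth.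
apply/seteqP; split=> [_ -> //|z zy].
by apply: eq_from_tnth => i; exact: zy.
Qed.

Lemma bm_discrete {R : realType} {disp} {T : measurableType disp} (s : seq T) : (forall x, x \in s) ->
  (forall A : set T, measurable A) ->
  forall f : T -> R, bounded_measurable f.
Proof.
move=> s_full all_meas f; split; first by move=> _ B _; exact: all_meas.
exists (\sum_(x <- undup s) `|f x|) => x.
have xs : x \in undup s by rewrite mem_undup.
by rewrite (big_rem x xs)/= lerDl sumr_ge0.
Qed.

End discrete.

Section bits.
Variable d : nat.
Local Notation Z := (d.-tuple bool).

Lemma measurable_bits (A : set Z) : measurable A.
Proof.
apply: countable_measurable; last exact: countableP.
by apply: measurable_tuple_set1 => b; exact: I.
Qed.

Lemma measurable_batch (k : nat) (A : set (k.-tuple Z)) : measurable A.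
Proof.
apply: countable_measurable; last exact: countableP.
by apply: measurable_tuple_set1 => z; exact: measurable_bits.
Qed.

Lemma measurable_batches (n k : nat) (A : set (n.-tuple (k.-tuple Z))) : measurable A.
Proof.
apply: countable_measurable; last exact: countableP.
by apply: measurable_tuple_set1 => z; exact: measurable_batch.
Qed.

Context {R : realType}.

Lemma bm_bits (f : Z -> R) : bounded_measurable f.
Proof.
apply: (@bm_discrete _ _ _ (enum {: Z})); last exact: measurable_bits.
by move=> x; rewrite mem_enum.
Qed.

Lemma bm_batch (k : nat) (f : k.-tuple Z -> R) : bounded_measurable f.
Proof.
apply: (@bm_discrete _ _ _ (enum {: k.-tuple Z})); last exact: measurable_batch.
by move=> x; rewrite mem_enum.
Qed.

Lemma bm_batches (n k : nat) (f : n.-tuple (k.-tuple Z) -> R) : bounded_measurable f.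
Proof.
apply: (@bm_discrete _ _ _ (enum {: n.-tuple (k.-tuple Z)})); last exact: measurable_batches.
by move=> x; rewrite mem_enum.
Qed.

Lemma sum_tuple_prod (F : 'I_d -> bool -> R) :
  \sum_(v : Z) \prod_j F j (tnth v j) = \prod_j (F j true + F j false).
Proof.
transitivity (\prod_(j < d) \sum_(b : bool) F j b); last first.
  by apply: eq_bigr => j _; rewrite big_bool.
rewrite bigA_distr_bigA (reindex (fun v : Z => [ffun j => tnth v j]))/=; last first.
  exists (fun f : {ffun 'I_d -> bool} => [tuple f j | j < d]) => [v _|f _].
    by apply: eq_from_tnth => j; rewrite tnth_mktuple ffunE.
  by apply/ffunP => j; rewrite ffunE tnth_mktuple.
by apply: eq_bigr => v _; apply: eq_bigr => j _; rewrite ffunE.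
Qed.

End bits.

Section mechanism.
Context {R : realType} {d : nat}.
Variable a : R.
Hypothesis a01 : 0 <= a <= 1 / 2.
Local Notation Z := (d.-tuple bool).
Implicit Types (b : bool) (v w : Z) (x j : 'I_d).

Let a0 : 0 <= a. Proof. by case/andP: a01. Qed.
Let a1 : a <= 1 / 2. Proof. by case/andP: a01. Qed.

(** The output of the mechanism is a vector of signs, encoded by booleans. *)
Definition sg b : R := (-1) ^+ b.

(** On input x, all the signs are uniform and independent except that the sign
    of index x has mean [a]. *)
Definition mech_weight x v : R := (1 + a * sg (tnth v x)) / 2 ^+ d.

Lemma mech_weight_bounds x v :
  0 <= 1 - a <= 2 ^+ d * mech_weight x v /\ 2 ^+ d * mech_weight x v <= 1 + a.
Proof.
have p2 : 2 ^+ d != 0 :> R by rewrite expf_neq0// pnatr_eq0.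
rewrite /mech_weight mulrC divfK//.
have [-> | ->] : sg (tnth v x) = 1 \/ sg (tnth v x) = -1.
  by rewrite /sg; case: (tnth _ _); [right; rewrite expr1|left; rewrite expr0].
all: clear p2; split; [apply/andP; split|]; move: a0 a1; lra.
Qed.

(** Expectation of a product of functions of the signs, which are independent. *)
Lemma mech_sum_prod x (F : 'I_d -> bool -> R) :
  \sum_v mech_weight x v * \prod_j F j (tnth v j) =
  \prod_j (((1 + (j == x)%:R * a) * F j false + (1 - (j == x)%:R * a) * F j true) / 2).
Proof.
transitivity (\sum_v \prod_j ((1 + (j == x)%:R * a * sg (tnth v j)) * F j (tnth v j) / 2)).
  apply: eq_bigr => v _; rewrite big_split/= big_split/=.
  rewrite [in RHS](bigD1 x)//= eqxx mul1r [in X in _ * X * _ * _]big1 ?mulr1.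
    by rewrite prodr_const card_ord exprVn /mech_weight mulrAC.
  by move=> j /negbTE ->; rewrite !mul0r addr0.
rewrite (sum_tuple_prod (fun j b => (1 + (j == x)%:R * a * sg b) * F j b / 2)).
by apply: eq_bigr => j _; rewrite /sg expr1 expr0; field.
Qed.

Lemma mech_in_simplex x :
  in_simplex [tuple mech_weight x (enum_val i) | i < #|{: Z}|].
Proof.
apply/andP; split.
  apply/forallP => i; rewrite tnth_mktuple.
  have [/andP[h0 h1] _] := mech_weight_bounds x (enum_val i).
  have p2 : 0 < 2 ^+ d :> R by exact: exprn_gt0.
  by rewrite -(pmulr_rge0 _ p2) (le_trans h0).
apply/eqP; under eq_bigr do rewrite tnth_mktuple.
rewrite -(big_enum_val (fun v => mech_weight x v))/=.
rewrite -[RHS](_ : \prod_(j < d) 1 = 1); last by rewrite big1.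
transitivity (\sum_v mech_weight x v * \prod_(j < d) 1).
  by apply: eq_bigr => v _; rewrite big1 ?mulr1.
rewrite (mech_sum_prod x (fun _ _ => 1)); apply: eq_bigr => j _.
by field.
Qed.

Definition mech x : probability Z R :=
  mixture (fun i : 'I_#|{: Z}| => \d_(enum_val i))
    (exist (fun p : #|{: Z}|.-tuple R => in_simplex p) _ (mech_in_simplex x)).

Lemma mean_dirac v (f : Z -> R) : mean (\d_v) f = f v.
Proof.
have [mf _] := bm_bits f.
by rewrite /mean /Rintegral integral_dirac ?diracT ?mul1e//; exact/measurable_EFinP.
Qed.

Lemma mean_mech x (f : Z -> R) : mean (mech x) f = \sum_v mech_weight x v * f v.
Proof.
rewrite mean_mixture; last exact: bm_bits.
rewrite [RHS](big_enum_val (fun v => mech_weight x v * f v))/=.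
by apply: eq_bigr => i _; rewrite tnth_mktuple mean_dirac.
Qed.

(** Densities of the mechanism lie between 1 - a and 1 + a up to a common factor,
    and (1 + a) / (1 - a) <= exp(3 a) for a <= 1/2. *)
Lemma mech_LDP (alpha : R) : 3 * a <= alpha -> LDP alpha mech.
Proof.
have ha0 := a0; have ha1 := a1; move=> a_alpha; apply: le_LDP => x x' B mB.
rewrite /mech /mixture ge0_sume_distrr//; last first.
  by move=> i _; rewrite mule_ge0// lee_fin; have /andP[/forallP] := mech_in_simplex x'.
apply: lee_sum => i _; rewrite muleA lee_wpmul2r// -EFinM lee_fin !tnth_mktuple.
set v := enum_val i.
have [_ h2] := mech_weight_bounds x v.
have [/andP[h0 h1] _] := mech_weight_bounds x' v.
have p2 : 0 < 2 ^+ d :> R by exact: exprn_gt0.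
rewrite -(ler_pM2l p2) (le_trans h2)// mulrCA.
apply: (@le_trans _ _ (expR alpha * (1 - a))); last by rewrite ler_wpM2l ?expR_ge0.
have e1 : 1 + a <= expR a by exact: expR_ge1Dx.
have e2 : expR (- (2 * a)) <= 1 - a.
  have e3 : 1 + 2 * a <= expR (2 * a) by exact: expR_ge1Dx.
  have e4 : expR (- (2 * a)) * expR (2 * a) = 1 by rewrite -expRD addNr expR0.
  have e5 : expR (- (2 * a)) * (1 + 2 * a) <= 1.
    by rewrite -[leRHS]e4 ler_wpM2l ?expR_ge0.
  have : 1 <= (1 - a) * (1 + 2 * a) by nra.
  by move=> /(le_trans e5); rewrite ler_pM2r//; lra.
apply: (le_trans e1).
have -> : a = alpha + (- (2 * a) + (3 * a - alpha)) by ring.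
rewrite expRD ler_wpM2l ?expR_ge0//.
rewrite [X in _ <= 1 - X](_ : _ = a); last by ring.
rewrite (le_trans _ e2)// ler_expR; lra.
Qed.

(** Projection of an output on the direction [w]; its expectation is [a] times
    the projection [lin w p] of the distribution. *)
Definition stat w v : R := \sum_j sg (tnth w j) * sg (tnth v j).
Definition lin w (p : simplex R d) : R := \sum_j sg (tnth w j) * tnth (val p) j.

Lemma norm_sg b : `|sg b| = 1.
Proof. by rewrite /sg normrX normrN1 expr1n. Qed.

Lemma norm_lin w p : `|lin w p| <= 1.
Proof.
rewrite /lin (le_trans (ler_norm_sum _ _ _))// -(simplex_sum1 p).
by apply: ler_sum => j _; rewrite normrM norm_sg mul1r ger0_norm ?simplex_ge0.
Qed.

(** The mixture over the inputs is linear in the moment generating function of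
    the only biased sign, which yields a sign of mean a (lin w p) times d - 1
    independent uniform signs. *)
Lemma mean_stat_mgf w p t :
  mean (mixture mech p) (fun v => expR (t * (stat w v - a * lin w p))) <=
  expR (2 * d%:R * t ^+ 2).
Proof.
have ha0 := a0; have ha1 := a1; set m := lin w p.
have d_gt0 : (0 < d)%N.
  rewrite lt0n; apply/eqP => d0; have := simplex_sum1 p.
  have e0 (i : 'I_d) : False by have := leq_ltn_trans (leq0n i) (ltn_ord i); rewrite d0.
  by rewrite big1 => [/eqP|i _]; [rewrite eq_sym oner_eq0|case: (e0 i)].
have -> : mean (mixture mech p) (fun v => expR (t * (stat w v - a * m))) =
    cosh t ^+ d.-1 * ((cosh t + (a * m) * sinh t) * expR (- (a * m * t))).
  rewrite (_ : (fun v => _) = (fun v => expR (- (a * m * t)) *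
      \prod_j expR (t * (sg (tnth w j) * sg (tnth v j))))); last first.
    apply/funext => v; rewrite -expR_sum -expRD -mulr_sumr -/(stat w v).
    by congr expR; ring.
  rewrite meanZ; last exact: bm_bits.
  rewrite mulrA mulrC; congr (_ * _).
  rewrite mean_mixture; last exact: bm_bits.
  transitivity (\sum_j tnth (val p) j *
      (cosh t ^+ d.-1 * (cosh t + a * sg (tnth w j) * sinh t))).
    apply: eq_bigr => x _; congr (_ * _).
    rewrite mean_mech (mech_sum_prod x (fun j b => expR (t * (sg (tnth w j) * sg b)))).
    rewrite (bigD1 x)//= eqxx mul1r mulrC; congr (_ * _).
      rewrite (eq_bigr (fun=> cosh t)) => [|j /negbTE ->].
        by rewrite prodr_const cardC1 card_ord.
      rewrite mul0r addr0 subr0 !mul1r /cosh /sg expr1 expr0; case: (tnth _ _).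
        by rewrite expr1 mulr1 mulrNN mulr1 mulrN1 addrC mulr1.
      by rewrite expr0 !mul1r mulr1 mulrN1.
    rewrite /cosh /sinh /sg expr1 expr0; case: (tnth _ _).
      by rewrite expr1 mulr1 mulrNN mulr1 mulrN1 mulr1; field.
    by rewrite expr0 !mul1r mulr1 mulrN1; field.
  rewrite (eq_bigr (fun j => cosh t ^+ d.-1 * (cosh t * tnth (val p) j +
      (a * sinh t) * (sg (tnth w j) * tnth (val p) j)))); last by move=> j _; ring.
  rewrite -mulr_sumr big_split/= -!mulr_sumr simplex_sum1 mulr1 -/(lin w p) -/m.
  by congr (_ * (_ + _)); ring.
have am : -1 <= a * m <= 1.
  rewrite -ler_norml normrM ger0_norm// mulr_ile1//; first by lra.
  exact: norm_lin.
have /andP[h0 h1] := cosh_sinh_le t am.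
apply: (@le_trans _ _ (expR (t ^+ 2) ^+ d.-1 * expR (t ^+ 2) ^+ 2)).
  apply: ler_pM => //; first by rewrite exprn_ge0// ltW// cosh_gt0.
  by rewrite lerXn2r ?nnegrE ?expR_ge0 ?cosh_le// ltW// cosh_gt0.
rewrite -exprD -expRM_natr ler_expR mulrC ler_wpM2r ?sqr_ge0//.
rewrite -[2]/(2%:R) -natrM ler_nat; move: d_gt0; case: (d) => // d' _.
by rewrite addn2 mul2n -addnn addSn addnS !ltnS leq_addr.
Qed.

End mechanism.

(** * Concentration and compatibility with a contaminated sample *)

Section concentration.
Context {R : realType} {d k : nat} (a : R).
Hypothesis a01 : 0 <= a <= 1 / 2.
Local Notation Z := (d.-tuple bool).
Variable p : simplex R d.
Implicit Types (w : Z).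

Definition centered w (b : k.-tuple Z) : R :=
  \sum_(l < k) (stat w (tnth b l) - a * lin w p).

Lemma mean_centered_mgf w t :
  0 <= mean (iid_law (mixture (mech a01) p) k) (fun b => expR (t * centered w b)) <=
  expR (2 * d%:R * t ^+ 2) ^+ k.
Proof.
rewrite mean_ge0/= => [|b]; last exact: expR_ge0.
rewrite (_ : (fun b => _) = (fun b => \prod_(l < k)
    expR (t * (stat w (tnth b l) - a * lin w p)))); last first.
  by apply/funext => b; rewrite -expR_sum -mulr_sumr.
rewrite (mean_iid_prod _ (f := fun _ v => expR (t * (stat w v - a * lin w p)))); last first.
  by move=> _; exact: bm_bits.
rewrite prodr_const card_ord lerXn2r ?nnegrE ?expR_ge0 ?mean_stat_mgf//.
by apply: mean_ge0 => v; exact: expR_ge0.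
Qed.

(** Chernoff's bound for the sum over the batches in J, at the optimal
    parameter. *)
Lemma centered_tail (n' s : nat) w (J : {set 'I_n'}) (x t : R) :
  (0 < d)%N -> (0 < k)%N -> (0 < s)%N -> (#|J| <= s)%N ->
  t = x / (4 * d%:R * k%:R * s%:R) ->
  mean (iid_law (iid_law (mixture (mech a01) p) k) n')
    (fun y => expR (t * (\sum_(i in J) centered w (tnth y i) - x))) <=
  expR (- (x ^+ 2 / (8 * d%:R * k%:R * s%:R))).
Proof.
move=> d0 k0 s0 Js tE.
have d0' : 0 < d%:R :> R by rewrite ltr0n.
have k0' : 0 < k%:R :> R by rewrite ltr0n.
have s0' : 0 < s%:R :> R by rewrite ltr0n.
rewrite (_ : (fun y => _) = (fun y => expR (- (t * x)) * \prod_(i < n')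
    (if i \in J then expR (t * centered w (tnth y i)) else 1))); last first.
  apply/funext => y; rewrite -big_mkcond -expR_sum -expRD -mulr_sumr.
  by congr expR; ring.
rewrite meanZ; last exact: bm_batches.
rewrite (mean_iid_prod _ (f := fun i b => if i \in J then expR (t * centered w b) else 1));
  last by move=> i; exact: bm_batch.
have [M0 M1] := andP (mean_centered_mgf w t).
set M := mean _ _ in M0 M1.
rewrite (_ : \prod_(i < n') _ = M ^+ #|J|); last first.
  rewrite -prodr_const [RHS]big_mkcond; apply: eq_bigr => i _.
  by case: (i \in J) => //; rewrite mean_cst.
apply: (@le_trans _ _ (expR (- (t * x)) * expR (2 * d%:R * k%:R * s%:R * t ^+ 2))).
  rewrite ler_wpM2l ?expR_ge0//.
  apply: (@le_trans _ _ ((expR (2 * d%:R * t ^+ 2) ^+ k) ^+ #|J|)).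
    by rewrite lerXn2r// nnegrE ?exprn_ge0 ?expR_ge0.
  rewrite -!expRM_natr ler_expR.
  have -> : 2 * d%:R * k%:R * s%:R * t ^+ 2 = 2 * d%:R * t ^+ 2 * k%:R * s%:R by ring.
  rewrite ler_wpM2l ?ler_nat//.
  by apply: mulr_ge0; [apply: mulr_ge0; [apply: mulr_ge0|exact: sqr_ge0]|].
rewrite -expRD ler_expR le_eqVlt; apply/orP; left; apply/eqP.
by rewrite tE; field; rewrite !gt_eqF.
Qed.

End concentration.

Section counting.
Context {R : realType}.

(** Each set J of at most m elements satisfies 1 <= eps^(|J| - m), and the sum of
    eps^|J| over all sets J is (1 + eps)^n' <= exp(n' eps). *)
Lemma card_small_sets (n' m : nat) (eps : R) : 0 < eps -> eps < 1 ->
  n'%:R * eps <= m%:R ->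
  (\sum_(J : {set 'I_n'} | (#|J| <= m)%N) 1 : R) <= expR (m%:R * (1 + ln (1 / eps))).
Proof.
move=> e0 e1 nm.
have em0 : 0 < eps ^+ m by exact: exprn_gt0.
apply: (@le_trans _ _ (\sum_(J : {set 'I_n'}) eps ^+ #|J| / eps ^+ m)).
  rewrite big_mkcond; apply: ler_sum => J _; case: ifP => Jm.
    by rewrite ler_pdivlMr// mul1r ler_wiXn2l// ltW.
  by rewrite divr_ge0// ?exprn_ge0// ltW.
rewrite -mulr_suml.
rewrite (_ : \sum_J _ = (1 + eps) ^+ n'); last first.
  transitivity (\prod_(i < n') (eps + 1)); last by rewrite prodr_const card_ord addrC.
  rewrite bigA_distr/=; apply: eq_bigr => J _.
  by rewrite -prodr_const big_mkcond.
rewrite ler_pdivrMr//.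
have inv : expR (m%:R * ln (1 / eps)) * eps ^+ m = 1.
  by rewrite expRM_natl lnK ?posrE ?divr_gt0// -exprMn mul1r mulVf ?expr1n ?gt_eqF.
rewrite mulrDr mulr1 expRD -mulrA inv mulr1.
apply: (@le_trans _ _ (expR (n'%:R * eps))); last by rewrite ler_expR.
by rewrite expRM_natl lerXn2r ?nnegrE ?expR_ge0 ?expR_ge1Dx//; lra.
Qed.

End counting.

Section robust_estimator.
Context {R : realType} {d k : nat} (a : R).
Local Notation Z := (d.-tuple bool).
Variables (n m : nat) (x : R).
Implicit Types (w : Z) (z : n.-tuple (k.-tuple Z)) (p : simplex R d).

(** After deletion of some set of m batches, deletion of any further m batches
    leaves empirical projections that are close to those of p. Asking this for
    every further deletion makes any two compatible distributions comparable
    on a common set of batches. *)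
Definition compatible z p : Prop := exists J0 : {set 'I_n}, (#|J0| <= m)%N /\
  forall w (J1 : {set 'I_n}), (#|J1| <= m)%N ->
    `|\sum_(b in ~: (J0 :|: J1)) centered a p w (tnth z b)| <= x.

Lemma centeredB p p' w (b : k.-tuple Z) :
  centered a p w b - centered a p' w b = a * k%:R * (lin w p' - lin w p).
Proof.
rewrite /centered -sumrB (eq_bigr (fun=> a * (lin w p' - lin w p))) => [|l _].
  by rewrite sumr_const card_ord -mulr_natl; ring.
ring.
Qed.

(** The l1 norm is the maximum of the projections on sign vectors. *)
Lemma lin_l1_dist p p' : exists w, lin w p - lin w p' = l1_dist (val p) (val p').
Proof.
exists [tuple (tnth (val p) j < tnth (val p') j) | j < d].
rewrite /lin /l1_dist -sumrB; apply: eq_bigr => j _; rewrite tnth_mktuple -mulrBr.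
rewrite /sg; case: ltP => h.
  by rewrite ltr0_norm ?subr_lt0// expr1 mulN1r.
by rewrite expr0 mul1r ger0_norm// subr_ge0.
Qed.

(** Delete the batches of both J0's: the remaining ones, at least n - 2 m, have
    projections close to those of p and of p'. *)
Lemma compatible_close z p p' : 0 <= a -> (2 * m <= n)%N ->
  compatible z p -> compatible z p' ->
  (n - 2 * m)%:R * (a * k%:R) * l1_dist (val p) (val p') <= 2 * x.
Proof.
move=> a0 mn [J [Jm Jx]] [J' [J'm J'x]].
have [w <-] := lin_l1_dist p p'.
have h := Jx w J' J'm; have h' := J'x w J Jm; rewrite finset.setUC in h'.
set A := (~: (J :|: J'))%SET in h h'.
have cardA : (n - 2 * m <= #|A|)%N.
  rewrite cardsCs finset.setCK card_ord leq_sub2l// mul2n -addnn.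
  by rewrite (leq_trans (leq_card_setU _ _).1)// leq_add.
have [pp'|pp'] := leP (lin w p - lin w p') 0.
  have x0 : 0 <= x by exact: le_trans h.
  apply: (@le_trans _ _ 0); last by rewrite mulr_ge0.
  by rewrite mulr_ge0_le0// mulr_ge0// mulr_ge0.
have hd : \sum_(b in A) centered a p' w (tnth z b) -
    \sum_(b in A) centered a p w (tnth z b) = #|A|%:R * (a * k%:R * (lin w p - lin w p')).
  rewrite -sumrB (eq_bigr (fun=> a * k%:R * (lin w p - lin w p'))) => [|b _].
    by rewrite sumr_const -[LHS]mulr_natl.
  exact: centeredB.
have : \sum_(b in A) centered a p' w (tnth z b) -
    \sum_(b in A) centered a p w (tnth z b) <= 2 * x.
  by move: h h'; rewrite !ler_norml => /andP[h1 h2] /andP[h3 h4]; lra.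
rewrite hd; apply: le_trans; rewrite -mulrA ler_wpM2r ?ler_nat//.
by rewrite !mulr_ge0// ltW.
Qed.

End robust_estimator.

Section clean_stability.
Context {R : realType} {d k : nat} (a : R) {n : nat} {eps : R}.
Local Notation Z := (d.-tuple bool).
Local Notation n' := (nb_clean n eps).
Variables (p : simplex R d) (x0 x1 : R) (m : nat).
Implicit Types (w : Z).
Hypothesis m_eps : m%:R = n%:R * eps.

(** One-sided bounds suffice, since negating w negates the projections. The
    sums over few batches need a bound of their own: a union bound over the
    complements of small sets would lose a factor 1 / sqrt(eps). *)
Definition stable (y : n'.-tuple (k.-tuple Z)) : Prop :=
  (forall w, \sum_(i < n') centered a p w (tnth y i) <= x0) /\
  (forall w (J : {set 'I_n'}), (#|J| <= m)%N ->
    \sum_(i in J) centered a p w (tnth y i) <= x1).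

Lemma centeredN w (b : k.-tuple Z) :
  centered a p (map_tuple negb w) b = - centered a p w b.
Proof.
rewrite /centered -sumrN; apply: eq_bigr => l _.
have sgN (c : bool) : sg (~~ c) = - sg c :> R.
  by case: c; rewrite /sg expr0 expr1 ?opprK.
have -> (v : Z) : stat (map_tuple negb w) v = - stat w v :> R.
  rewrite /stat -sumrN; apply: eq_bigr => j _.
  by rewrite tnth_map sgN mulNr.
have -> : lin (map_tuple negb w) p = - lin w p.
  by rewrite /lin -sumrN; apply: eq_bigr => j _; rewrite tnth_map sgN mulNr.
ring.
Qed.

Lemma contaminationP (y : n'.-tuple (k.-tuple Z)) z : contamination y z ->
  exists s : 'I_n' -> 'I_n, [/\ injective s, (forall i, tnth z (s i) = tnth y i) &
    (#|~: [set s i | i in 'I_n']| = m)%N].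
Proof.
move=> [J [cardJ /tuple_permP[q zq]]].
have szJ : size (enum (~: J)%SET) = n'.
  by have := congr1 size zq; rewrite size_map size_tuple.
have sz (i : 'I_n') : (i < size (enum (~: J)%SET))%N by rewrite szJ.
pose e (i : 'I_n') := enum_val (cast_ord (etrans (esym szJ) (esym (cardE _))) i).
have eE (i : 'I_n') b0 : e i = nth b0 (enum (~: J)%SET) i.
  by rewrite /e (enum_val_nth b0).
have e_inj : injective e by move=> i j /enum_val_inj/cast_ord_inj.
have eJ i : e i \in (~: J)%SET by exact: enum_valP.
have ze i : tnth z (e i) = tnth y (q i).
  have := congr1 (fun t => nth (tnth y i) t i) zq.
  rewrite (nth_map (e i)) // -eE => ->.
  by rewrite -tnth_nth tnth_mktuple.
exists (fun i => e (q^-1%g i)); split.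
- by move=> i j /e_inj/perm_inj.
- by move=> i; rewrite ze permKV.
- have -> : [set e (q^-1%g i) | i in 'I_n']%SET = (~: J)%SET.
    apply/eqP; rewrite eqEcard; apply/andP; split.
      by apply/fintype.subsetP => _ /imsetP[i _ ->]; exact: eJ.
    rewrite card_imset ?card_ord; last by move=> i j /e_inj/perm_inj.
    by rewrite cardE szJ.
  rewrite finset.setCK; apply/eqP; rewrite -(eqr_nat R) cardJ m_eps//.
Qed.

(** The truth is compatible with every contamination of a stable sample: what
    remains after deleting J1 is the clean sample without a small part of it. *)
Lemma stable_compatible y z : stable y -> contamination y z ->
  compatible a m (x0 + x1) z p.
Proof.
move=> [st0 st1] /contaminationP[s [s_inj zs card_m]].
exists (~: [set s i | i in 'I_n'])%SET; split; first by rewrite card_m.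
move=> w J1 J1m.
pose J := [set i | s i \in J1]%SET.
have Jm : (#|J| <= m)%N.
  rewrite (leq_trans _ J1m)// -(card_imset _ s_inj).
  by apply: subset_leq_card; apply/fintype.subsetP => _ /imsetP[i + ->]; rewrite inE.
have sumE w' : \sum_(b in ~: (~: [set s i | i in 'I_n']%SET :|: J1)) centered a p w' (tnth z b) =
    \sum_(i < n') centered a p w' (tnth y i) - \sum_(i in J) centered a p w' (tnth y i).
  rewrite finset.setCU finset.setCK -finset.setDE.
  set F := fun b => centered a p w' (tnth z b).
  have FE i : F (s i) = centered a p w' (tnth y i) by rewrite /F zs.
  have im_all : \sum_(b in [set s i | i in 'I_n']%SET) F b = \sum_(i < n') F (s i).
    by rewrite big_imset//= => i j _ _; exact: s_inj.
  have im_J : \sum_(b in [set s i | i in 'I_n']%SET :&: J1) F b = \sum_(i in J) F (s i).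
    rewrite -(big_imset F (in2W s_inj)); apply: eq_bigl => b; rewrite finset.in_setI.
    apply/andP/imsetP => [[/imsetP[i _ ->] siJ]|[i]].
      by exists i => //; rewrite inE.
    by rewrite inE => siJ ->; split=> //; exact: imset_f.
  rewrite -(eq_bigr _ (fun i _ => FE i)) -[in RHS](eq_bigr _ (fun i _ => FE i)).
  by rewrite -im_all -im_J [in RHS](big_setID J1)/= addrAC subrr add0r.
have up w' : \sum_(b in ~: (~: [set s i | i in 'I_n']%SET :|: J1)) centered a p w' (tnth z b)
    <= x0 + x1.
  rewrite sumE lerD//.
  have := st1 (map_tuple negb w') J Jm; under eq_bigr do rewrite centeredN.
  by rewrite sumrN.
rewrite ler_norml up andbT lerNl.
have := up (map_tuple negb w); under eq_bigr do rewrite centeredN.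
by rewrite sumrN.
Qed.

End clean_stability.

(** * The robust estimator and its risk *)

Section upper_bound.
Context {R : realType} (d n k : nat) (alpha eps : R).
Hypotheses (d3 : (3 <= d)%N) (n1 : (1 <= n)%N) (k1 : (1 <= k)%N).
Hypotheses (alpha01 : 0 < alpha < 1) (eps01 : 0 < eps < 1 / 4).
Hypothesis int_n : n%:R * (1 - eps) \is a Num.int.

Local Notation n' := (nb_clean n eps).
Local Notation m := (n - nb_clean n eps)%N.
Local Notation Z := (d.-tuple bool).
Local Notation L := (ln (1 / eps)).

Let alpha0 : 0 < alpha. Proof. by case/andP: alpha01. Qed.
Let eps0 : 0 < eps. Proof. by case/andP: eps01. Qed.
Let d_gt0 : (0 < d)%N. Proof. exact: leq_trans d3. Qed.
Let d0 : 0 < d%:R :> R. Proof. by rewrite ltr0n. Qed.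
Let n0 : 0 < n%:R :> R. Proof. by rewrite ltr0n. Qed.
Let k0 : 0 < k%:R :> R. Proof. by rewrite ltr0n. Qed.

Let mE : m%:R = n%:R * eps. Proof. exact: nb_contaminated. Qed.
Let m0 : 0 < m%:R :> R. Proof. by rewrite mE mulr_gt0. Qed.
Let m_gt0 : (0 < m)%N. Proof. by rewrite -(ltr_nat R). Qed.

Lemma ln_inv_ge1 : 1 <= L.
Proof.
rewrite -ler_expR lnK ?posrE ?divr_gt0// ler_pdivlMr//.
have [_ e4] := andP eps01.
have h1 : 1 - 1 / 2 <= expR (- (1 / 2)) :> R by exact: expR_ge1Dx.
have h2 : expR (1 / 2) * expR (- (1 / 2)) = 1 :> R by rewrite -expRD subrr expR0.
have h3 : expR (1 / 2) * (1 - 1 / 2) <= 1 :> R.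
  by rewrite -[leRHS]h2 ler_wpM2l ?expR_ge0.
have h4 : expR (1 / 2) <= 2 :> R by lra.
have h5 : expR 1 <= 4 :> R.
  have -> : expR 1 = expR (1 / 2) * expR (1 / 2) :> R.
    by rewrite -expRD; congr expR; field.
  have h0 := expR_ge0 (1 / 2 : R).
  have -> : 4 = 2 * 2 :> R by ring.
  exact: ler_pM.
have h0 := expR_ge0 (1 : R).
apply: (@le_trans _ _ (4 * eps)); first by rewrite ler_wpM2r// ltW.
lra.
Qed.

Let a : R := alpha / 3.

Let a01 : 0 <= a <= 1 / 2.
Proof.
have /andP[h0 h1] := alpha01.
by rewrite /a; apply/andP; split; lra.
Qed.

Let x0 : R := 5 * d%:R * Num.sqrt (k%:R * n%:R).
Let x1 : R := 5 * d%:R * Num.sqrt (k%:R * m%:R) + 4 * m%:R * Num.sqrt (d%:R * k%:R * L).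

Let Q := mech (d := d) a01.

Lemma x0_sqr : 3 * d%:R <= x0 ^+ 2 / (8 * d%:R * k%:R * n%:R).
Proof.
have c0 : 0 < 8 * d%:R * k%:R * n%:R :> R by rewrite !mulr_gt0.
rewrite ler_pdivlMr// /x0 exprMn sqr_sqrtr; last by rewrite mulr_ge0 ?ltW.
have h : 0 <= d%:R ^+ 2 * (k%:R * n%:R) :> R by rewrite mulr_ge0 ?sqr_ge0// mulr_ge0 ?ltW.
rewrite -subr_ge0 (_ : _ - _ = d%:R ^+ 2 * (k%:R * n%:R))//; ring.
Qed.

Lemma x1_sqr : 3 * d%:R + 2 * m%:R * L <= x1 ^+ 2 / (8 * d%:R * k%:R * m%:R).
Proof.
have c0 : 0 < 8 * d%:R * k%:R * m%:R :> R by rewrite !mulr_gt0.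
have L0 : 0 <= L by exact: le_trans ln_inv_ge1.
rewrite ler_pdivlMr// /x1.
set s := Num.sqrt (k%:R * m%:R); set t := Num.sqrt (d%:R * k%:R * L).
have s2 : s ^+ 2 = k%:R * m%:R by rewrite sqr_sqrtr// mulr_ge0 ?ltW.
have t2 : t ^+ 2 = d%:R * k%:R * L by rewrite sqr_sqrtr// mulr_ge0// mulr_ge0 ?ltW.
have h1 : 0 <= d%:R ^+ 2 * (k%:R * m%:R) :> R by rewrite mulr_ge0 ?sqr_ge0// mulr_ge0 ?ltW.
have h2 : 0 <= 2 * (5 * d%:R * s) * (4 * m%:R * t).
  have s0 : 0 <= s by exact: sqrtr_ge0.
  have t0 : 0 <= t by exact: sqrtr_ge0.
  by apply: mulr_ge0; [apply: mulr_ge0 => //; apply: mulr_ge0|apply: mulr_ge0] => //;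
    apply: mulr_ge0 => //; exact: ltW.
have -> : (5 * d%:R * s + 4 * m%:R * t) ^+ 2 = 25 * d%:R ^+ 2 * s ^+ 2 +
    16 * m%:R ^+ 2 * t ^+ 2 + 2 * (5 * d%:R * s) * (4 * m%:R * t) by ring.
rewrite s2 t2 -subr_ge0.
set X := 2 * (5 * d%:R * s) * (4 * m%:R * t) in h2 *.
rewrite (_ : _ - _ = d%:R ^+ 2 * (k%:R * m%:R) + X); first exact: addr_ge0.
ring.
Qed.

(** Union bound over the 2^d directions and over the sets J of at most m batches,
    at most exp(2 m L) of them; x0 and x1 were chosen to make each tail at most
    exp(- 3 d) and exp(- 3 d - 2 m L) respectively. *)
Lemma unstable_prob (p : simplex R d) :
  mean (clean_law n k eps Q p) \1_[set y | ~ stable a p x0 x1 m y] <= expR (- d%:R).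
Proof.
pose t0 : R := x0 / (4 * d%:R * k%:R * n%:R).
pose t1 : R := x1 / (4 * d%:R * k%:R * m%:R).
have sqrt0 (u : R) : 0 <= Num.sqrt u by exact: sqrtr_ge0.
have t00 : 0 <= t0.
  apply: divr_ge0; first by apply: mulr_ge0 => //; apply: mulr_ge0 => //; exact: ltW.
  by rewrite ltW// !mulr_gt0.
have t10 : 0 <= t1.
  apply: divr_ge0; last by rewrite ltW// !mulr_gt0.
  by apply: addr_ge0; apply: mulr_ge0 => //; apply: mulr_ge0 => //; exact: ltW.
pose f0 w (y : n'.-tuple (k.-tuple Z)) : R :=
  expR (t0 * (\sum_(i in [set: 'I_n']%SET) centered a p w (tnth y i) - x0)).
pose f1 w (J : {set 'I_n'}) (y : n'.-tuple (k.-tuple Z)) : R :=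
  expR (t1 * (\sum_(i in J) centered a p w (tnth y i) - x1)).
have f0_ge0 w y : 0 <= f0 w y by exact: expR_ge0.
have f1_ge0 w J y : 0 <= f1 w J y by exact: expR_ge0.
apply: (@le_trans _ _ (mean (clean_law n k eps Q p)
    (fun y => \sum_w f0 w y + \sum_w \sum_(J : {set 'I_n'} | (#|J| <= m)%N) f1 w J y))).
  apply: le_mean; [exact: bm_batches|exact: bm_batches|] => y.
  have S0 : 0 <= \sum_w f0 w y by exact: sumr_ge0.
  have S1 : 0 <= \sum_w \sum_(J : {set 'I_n'} | (#|J| <= m)%N) f1 w J y.
    by apply: sumr_ge0 => w _; exact: sumr_ge0.
  have [st|st] := pselect (stable a p x0 x1 m y).
    by rewrite indicE memNset ?addr_ge0//= => /(_ st).
  rewrite indicE mem_set//=.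
  move/not_andP : st => [|] /existsNP[w].
    move=> /negP; rewrite -ltNge => h.
    rewrite (@le_trans _ _ (f0 w y))//; last first.
      by rewrite (bigD1 w)//= -addrA lerDl addr_ge0// sumr_ge0.
    rewrite /f0 -[leLHS]expR0 ler_expR mulr_ge0// subr_ge0.
    by rewrite big_set/= ltW.
  move=> /existsNP[J /not_implyP[Jm /negP]]; rewrite -ltNge => h.
  rewrite (@le_trans _ _ (f1 w J y))//; last first.
    rewrite addrC (bigD1 w)//= (bigD1 J)//= -!addrA lerDl !addr_ge0 ?sumr_ge0// => w' _.
    exact: sumr_ge0.
  by rewrite /f1 -[leLHS]expR0 ler_expR mulr_ge0// subr_ge0 ltW.
rewrite meanD; [|exact: bm_batches|exact: bm_batches].
rewrite mean_sum => [|w]; last exact: bm_batches.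
rewrite mean_sum => [|w]; last exact: bm_batches.
have b0 w : mean (clean_law n k eps Q p) (f0 w) <= expR (- (3 * d%:R)).
  have card_T : (#|[set: 'I_n']%SET| <= n)%N by rewrite cardsT card_ord nb_clean_le.
  have C := @centered_tail _ _ _ _ a01 p _ _ w _ x0 t0 d_gt0 k1 n1 card_T erefl.
  by apply: le_trans C _; rewrite ler_expR lerN2 x0_sqr.
have b1 w (J : {set 'I_n'}) : (#|J| <= m)%N ->
    mean (clean_law n k eps Q p) (f1 w J) <= expR (- (3 * d%:R + 2 * m%:R * L)).
  move=> Jm.
  have C := @centered_tail _ _ _ _ a01 p _ _ w _ x1 t1 d_gt0 k1 m_gt0 Jm erefl.
  by apply: le_trans C _; rewrite ler_expR lerN2 x1_sqr.
have card_w : #|{: Z}|%:R <= expR d%:R :> R.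
  rewrite card_tuple card_bool natrX -[d%:R]mul1r mulrC expRM_natl.
  by rewrite lerXn2r ?nnegrE ?expR_ge0// (le_trans _ (expR_ge1Dx 1)).
have B0 : \sum_w mean (clean_law n k eps Q p) (f0 w) <= expR (- (2 * d%:R)).
  apply: (@le_trans _ _ (\sum_(w : Z) expR (- (3 * d%:R)))).
    by apply: ler_sum => w _; exact: b0.
  rewrite sumr_const -[leLHS]mulr_natl (@le_trans _ _ (expR d%:R * expR (- (3 * d%:R))))//.
    by rewrite ler_wpM2r ?expR_ge0.
  by rewrite -expRD ler_expR; lra.
have eps1 : eps < 1 by have /andP[_] := eps01; lra.
have n'm : n'%:R * eps <= m%:R.
  by rewrite mE ler_wpM2r ?(ltW eps0)// ler_nat nb_clean_le.
have B1 : \sum_w mean (clean_law n k eps Q p)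
     (fun y => \sum_(J : {set 'I_n'} | (#|J| <= m)%N) f1 w J y) <= expR (- (2 * d%:R)).
  apply: (@le_trans _ _ (\sum_(w : Z)
      (expR (m%:R * (1 + L)) * expR (- (3 * d%:R + 2 * m%:R * L))))).
    apply: ler_sum => w _; rewrite mean_sum => [|J]; last exact: bm_batches.
    apply: (@le_trans _ _ (\sum_(J : {set 'I_n'} | (#|J| <= m)%N)
        (1 * expR (- (3 * d%:R + 2 * m%:R * L))))).
      by apply: ler_sum => J Jm; rewrite mul1r; exact: b1.
    by rewrite -mulr_suml ler_wpM2r ?expR_ge0// card_small_sets.
  rewrite sumr_const -[leLHS]mulr_natl (@le_trans _ _ (expR d%:R *
      (expR (m%:R * (1 + L)) * expR (- (3 * d%:R + 2 * m%:R * L)))))//.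
    by rewrite ler_wpM2r// mulr_ge0 ?expR_ge0.
  rewrite -!expRD ler_expR.
  have : m%:R * 1 <= m%:R * L by rewrite ler_wpM2l ?ln_inv_ge1.
  by lra.
apply: (le_trans (lerD B0 B1)).
have -> : - (2 * d%:R) = - d%:R + - d%:R :> R by ring.
rewrite expRD -mulrDr ger_pMr ?expR_gt0//.
have h1 : 1 + d%:R <= expR d%:R :> R by exact: expR_ge1Dx.
have h2 : expR d%:R * expR (- d%:R) = 1 :> R by rewrite -expRD subrr expR0.
have h3 : 2 <= expR d%:R :> R.
  by apply: le_trans h1; rewrite -[2]/(1 + 1) lerD2l ler1n.
rewrite -[leRHS]h2 -mulr2n -[leLHS]mulr_natl ler_wpM2r ?expR_ge0//.
Qed.

Let four_eps_le1 : 4 * eps <= 1.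
Proof. have [_ e4] := andP eps01; lra. Qed.

Let three_a_le : 3 * a <= alpha.
Proof. by rewrite /a; lra. Qed.

Lemma uniform_simplex : simplex R d.
Proof.
have v0d (j : 'I_(d./2)) : `|0 : R| <= d%:R^-1 by rewrite normr0 invr_ge0 ltW.
by have [p _] := perturbed_uniform (v := fun=> 0) d_gt0 v0d.
Qed.

Definition robust_estimator (z : n.-tuple (k.-tuple Z)) : simplex R d :=
  if pselect (exists p, compatible a m (x0 + x1) z p) is left ex_p
  then sval (cid ex_p) else uniform_simplex.

Lemma robust_estimator_compatible z p : compatible a m (x0 + x1) z p ->
  compatible a m (x0 + x1) z (robust_estimator z).
Proof.
move=> zp; rewrite /robust_estimator; case: pselect => [ex_p|]; first by case: cid.
by case; exists p.
Qed.

(** On a stable sample, the truth and the estimate are both compatible with the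
    contaminated sample, and n - 2 m is at least n / 2. If psi bounds all the
    distances, there are no bad events. *)
Lemma estimator_risk (psi : R) :
  (forall p p' : simplex R d, l1_dist (val p) (val p') <= psi) \/
  12 * (x0 + x1) / (alpha * (k%:R * n%:R)) <= psi ->
  (minimax_risk n k alpha d eps psi <= (expR (- d%:R))%:E)%E.
Proof.
move=> psiP; apply: ge_ereal_inf.
exists (ereal_sup [set mu_ext (clean_law n k eps Q p)
    (bad_event psi robust_estimator p) | p in [set: simplex R d]]); last first.
  apply: ge_ereal_sup => _ [p _ <-].
  pose U := [set y : n'.-tuple (k.-tuple Z) | ~ stable a p x0 x1 m y].
  have mU : measurable U by exact: measurable_batches.
  apply: (@le_trans _ _ (mu_ext (clean_law n k eps Q p) U)); last first.
    rewrite measurable_mu_extE// -[leLHS]fineK ?fin_num_measure//.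
    by rewrite lee_fin -mean_indic//; exact: unstable_prob.
  apply: le_mu_ext => y bad st; move: bad; apply/negP; rewrite -leNgt.
  apply: ge_ereal_sup => _ [z yz <-]; rewrite lee_fin.
  case: psiP => [-> //|]; apply: le_trans.
  have zp := stable_compatible mE st yz.
  have ze := robust_estimator_compatible zp.
  have [a_ge0 _] := andP a01.
  have mn : 4 * m%:R <= n%:R :> R.
    by rewrite mE mulrCA ger_pMr// four_eps_le1.
  have m_ge0 : 0 <= m%:R :> R by exact: ltW.
  have mn2 : (2 * m <= n)%N by rewrite -(ler_nat R) natrM; lra.
  have := compatible_close a_ge0 mn2 ze zp.
  rewrite natrB// natrM.
  set l := l1_dist _ _ => close.
  have l0 : 0 <= l by apply: sumr_ge0.
  rewrite ler_pdivlMr ?mulr_gt0//.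
  have h : n%:R / 2 * (a * k%:R) * l <= (n%:R - 2 * m%:R) * (a * k%:R) * l.
    have ak0 : 0 <= a * k%:R := mulr_ge0 a_ge0 (ltW k0).
    by rewrite ler_wpM2r// ler_wpM2r//; lra.
  have := le_trans h close; rewrite /a => h2.
  have -> : l * (alpha * (k%:R * n%:R)) = 6 * (n%:R / 2 * (alpha / 3 * k%:R) * l).
    by field.
  have -> : 12 * (x0 + x1) = 6 * (2 * (x0 + x1)) by ring.
  by rewrite ler_wpM2l.
exists _, _, Q, robust_estimator; split=> //.
- by apply: mech_LDP; exact: three_a_le.
- by move=> _ B _; exact: measurable_batches.
Qed.

Lemma l1_dist_le2 (p p' : simplex R d) : l1_dist (val p) (val p') <= 2.
Proof.
apply: (@le_trans _ _ (\sum_j (tnth (val p) j + tnth (val p') j))).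
  apply: ler_sum => j _; rewrite (le_trans (ler_normB _ _))//.
  by rewrite !ger0_norm ?simplex_ge0.
by rewrite big_split/= !simplex_sum1.
Qed.

Lemma radius_le : 12 * (x0 + x1) / (alpha * (k%:R * n%:R)) <=
  120 * (d%:R / (alpha * Num.sqrt (k%:R * n%:R)) +
     eps * Num.sqrt L / alpha * Num.sqrt (d%:R / k%:R)).
Proof.
have kn0 : 0 < k%:R * n%:R :> R by exact: mulr_gt0.
set s := Num.sqrt (k%:R * n%:R).
have s0 : 0 < s by rewrite sqrtr_gt0.
have s2 : k%:R * n%:R = s * s by rewrite -expr2 sqr_sqrtr// ltW.
have L0 : 0 <= L by exact: le_trans ln_inv_ge1.
have x0E : x0 = 5 * d%:R * s by [].
have x1_le : x1 <= 5 * d%:R * s +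
    4 * (n%:R * eps) * (k%:R * Num.sqrt (d%:R / k%:R) * Num.sqrt L).
  rewrite /x1 mE lerD//.
    rewrite ler_wpM2l ?mulr_ge0// ler_wsqrtr// ler_wpM2l ?(ltW k0)//.
    by rewrite -mE ler_nat leq_subr.
  have -> : d%:R * k%:R * L = k%:R ^+ 2 * (d%:R / k%:R) * L.
    by field; rewrite gt_eqF.
  rewrite sqrtrM; last by rewrite mulr_ge0 ?sqr_ge0// divr_ge0 ?ltW.
  by rewrite sqrtrM ?sqr_ge0// sqrtr_sqr ger0_norm.
rewrite ler_pdivrMr ?mulr_gt0//.
set u := Num.sqrt (d%:R / k%:R) in x1_le *; set t := Num.sqrt L in x1_le *.
have -> : 120 * (d%:R / (alpha * s) + eps * t / alpha * u) * (alpha * (k%:R * n%:R)) =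
    120 * d%:R * s + 120 * eps * t * u * (k%:R * n%:R).
  by rewrite s2; field; rewrite !gt_eqF.
have tu0 : 0 <= eps * t * u * (k%:R * n%:R).
  by rewrite mulr_ge0 ?(ltW kn0)// mulr_ge0 ?sqrtr_ge0// mulr_ge0 ?sqrtr_ge0// ltW.
rewrite x0E.
have := x1_le.
rewrite (_ : 4 * (n%:R * eps) * (k%:R * u * t) =
  4 * (eps * t * u * (k%:R * n%:R))); last by ring.
rewrite (_ : 120 * eps * t * u * (k%:R * n%:R) =
  120 * (eps * t * u * (k%:R * n%:R))); last by ring.
rewrite -!mulrA; lra.
Qed.

End upper_bound.

(** * The minimax rate *)

Theorem theorem2 (R : realType) :
  exists c0 c C C' C'' : R,
    [/\ 0 < c0 < 1 / 4, 0 < c, 0 < C, 0 < C' & 0 < C''] /\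
    forall (d n k : nat) (alpha eps : R),
      (3 <= d)%N -> (1 <= n)%N -> (1 <= k)%N ->
      0 < alpha < 1 -> 0 < eps < c0 ->
      n%:R * (1 - eps) \is a Num.int ->
      let delta := C' * expR (- d%:R) in
      ((c * Num.min (d%:R / (alpha * Num.sqrt (k%:R * n%:R))
                     + eps / alpha * Num.sqrt (d%:R / k%:R)) 1)%:E
         <= minimax_rate delta n k alpha d eps)%E
      /\
      (C'' * d%:R <= n%:R ->
       (minimax_rate delta n k alpha d eps
         <= (C * Num.min (d%:R / (alpha * Num.sqrt (k%:R * n%:R))
                          + eps * Num.sqrt (ln (1 / eps)) / alpha
                            * Num.sqrt (d%:R / k%:R)) 1)%:E)%E).
Proof.
exists (1 / 5), (1 / 600), 120, 1, 1; split; first by split; lra.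
move=> d n k alpha eps d3 n1 k1 alpha01 eps01 int_n delta.
have eps01' : 0 < eps < 1 / 4.
  by have /andP[-> e5] := eps01; rewrite /=; lra.
have d_le : 3 <= d%:R :> R by rewrite -[3]/(3%:R) ler_nat.
have delta8 : delta <= 1 / 8.
  rewrite /delta mul1r (@le_trans _ _ (expR (- 3)))//; first by rewrite ler_expR lerN2.
  have e2 : 2 <= expR 1 :> R by apply: le_trans (expR_ge1Dx 1).
  have e3 : expR 3 * expR (- 3) = 1 :> R by rewrite -expRD subrr expR0.
  have e8 : 8 <= expR 3 :> R.
    have -> : expR 3 = expR 1 ^+ 3 :> R by rewrite -expRM_natl mulr1.
    have -> : 8 = 2 ^+ 3 :> R by ring.
    by rewrite lerXn2r ?nnegrE ?expR_ge0.
  rewrite ler_pdivlMr// -[leRHS]e3 mulrC ler_wpM2r ?expR_ge0//.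
set r1 := d%:R / (alpha * _); set r2 := eps / alpha * _.
split=> [|_].
  apply: le_ereal_inf_tmp => _ [psi [psi0 risk] <-]; rewrite lee_fin.
  have risk8 : (minimax_risk n k alpha d eps psi <= (1 / 8)%:E)%E.
    by rewrite (le_trans risk)// lee_fin.
  have h1 := sampling_lower_bound d3 n1 k1 alpha01 eps01' int_n psi0 risk8.
  have h2 := contamination_lower_bound d3 n1 k1 alpha01 eps01' int_n risk8.
  rewrite -/r1 in h1; rewrite -/r2 in h2.
  have h : Num.min (r1 + r2) 1 <= Num.min r1 1 + Num.min r2 1.
    have alpha0 : 0 < alpha by case/andP: alpha01.
    have eps0 : 0 < eps by case/andP: eps01.
    have r10 : 0 <= r1 by rewrite divr_ge0// mulr_ge0 ?sqrtr_ge0// ltW.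
    have r20 : 0 <= r2 by rewrite mulr_ge0 ?sqrtr_ge0// divr_ge0 ?ltW.
    by case: (leP r1 1) => ?; case: (leP r2 1) => ?; case: (leP (r1 + r2) 1) => ?; lra.
  lra.
set r := _ + _.
have r0 : 0 < r.
  have alpha0 : 0 < alpha by case/andP: alpha01.
  have eps0 : 0 < eps by case/andP: eps01.
  have n0 : 0 < n%:R :> R by rewrite ltr0n.
  have k0 : 0 < k%:R :> R by rewrite ltr0n.
  rewrite ltr_wpDr//; last first.
    by rewrite divr_gt0 ?mulr_gt0 ?sqrtr_gt0 ?mulr_gt0//; lra.
  by rewrite mulr_ge0 ?sqrtr_ge0// divr_ge0 ?(ltW alpha0)// mulr_ge0 ?sqrtr_ge0 ?(ltW eps0).
apply: ge_ereal_inf; exists (120 * Num.min r 1)%:E => //.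
exists (120 * Num.min r 1) => //; split; first by rewrite mulr_gt0// lt_min r0 ltr01.
rewrite /delta mul1r; apply: estimator_risk => //.
have [r_le1|r_gt1] := leP r 1.
  by right; apply: radius_le.
by left=> p p'; apply: le_trans (l1_dist_le2 p p') _; lra.
Qed.
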